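(* Let $\varepsilon \in (0,1)$, $q > 0$, $\sigma>0$, and $\alpha = (1+\varepsilon)^{-1}$. Assume that: (i) for every sequence $(y_n)_{n\ge 1}$ of positive reals such that $N_n^{\alpha \varepsilon} \preccurlyeq y_n \preccurlyeq N_n^\alpha$, one has $\log \mathbb{P}(Y_n \geqslant y_n) \sim -q\, y_n^{1-\varepsilon}$ as $n\to\infty$; (ii) $\mathbb{E}[Y_n^2] \to \sigma^2$ as $n\to\infty$; (iii) there exists $\gamma \in (0,1]$ such that $\mathbb{E}[|Y_n|^{2+\gamma}] = o(N_n^{\gamma(1-\alpha)})$ as $n\to\infty$. Then, for all $y \geqslant 0$, $$\lim_{n \to \infty} \frac{1}{N_n^{(1-\varepsilon)/(1+\varepsilon)}} \log \mathbb{P}\bigl(T_n \geqslant N_n^{1/(1+\varepsilon)} y\bigr) = - \inf_{0\leqslant \theta \leqslant 1} \Bigl\{ q\,\theta^{1-\varepsilon} y^{1-\varepsilon}+\frac{(1-\theta)^2y^2}{2\sigma^2} \Bigr\}.$$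
   Context: For each $n \geqslant 1$, $Y_n$ is a centered real-valued random variable (i.e. integrable with mean $0$), $N_n\ge 1$ is a natural number with $N_n\to\infty$ as $n\to\infty$, and $(Y_{n,i})_{1\le i\le N_n}$ is a family of i.i.d. random variables distributed as $Y_n$. Set $T_n = \sum_{i=1}^{N_n} Y_{n,i}$. The notation $x_n \preccurlyeq y_n$ means $\limsup_{n\to\infty} |x_n/y_n| < \infty$, and $a_n\sim b_n$ means $a_n/b_n\to 1$. *)

(* Defs.v *)
From HB Require Import structures.
From mathcomp Require Import all_boot all_order all_algebra.
From mathcomp Require Import all_classical all_reals all_analysis.

Set Implicit Arguments.
Unset Strict Implicit.
Unset Printing Implicit Defensive.

Import Order.TTheory GRing.Theory Num.Theory.
Import numFieldNormedType.Exports.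

Local Open Scope classical_set_scope.
Local Open Scope ring_scope.

Definition same_law (R : realType) (d d' : measure_display)
    (Omega : measurableType d) (Omega' : measurableType d')
    (P : probability Omega R) (P' : probability Omega' R)
    (X : {RV P >-> R}) (Y : {RV P' >-> R}) : Prop :=
  forall A : set R, measurable A -> distribution P X A = distribution P' Y A.

(* Mutual independence: the product rule is required for every subfamily [J]. *)
Definition independent_RVs (R : realType) (d : measure_display)
    (Omega : measurableType d) (P : probability Omega R)
    (I : finType) (X : I -> {RV P >-> R}) : Prop :=
  forall (J : {set I}) (A : I -> set R),
    (forall i, i \in J -> measurable (A i)) ->
    P [set w | forall i, i \in J -> A i (X i w)] =
    (\prod_(i in J) P (X i @^-1` A i))%E.

Definition dominated (R : realType) (x y : nat -> R) : Prop :=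
  (limn_esup (fun n => `|x n / y n|%:E) < +oo)%E.

(* The numerator is extended-real so that logarithms of null probabilities
   ([lne 0 = -oo]) are allowed. *)
Definition asymp_equiv (R : realType) (a : nat -> \bar R) (b : nat -> R)
  : Prop :=
  (a n / (b n)%:E)%E @[n --> \oo] --> 1%E.

(* The numerator is extended-real so that expectations are not assumed finite. *)
Definition asymp_negligible (R : realType) (a : nat -> \bar R) (b : nat -> R)
  : Prop :=
  (a n / (b n)%:E)%E @[n --> \oo] --> 0%E.

(* Main.v *)
(* Write N = s r^2 and N^alpha = s r, where r = N^(alpha eps) and
   s = N^(alpha (1 - eps)) is the speed.

   Upper bound.  A term is a jump if it exceeds r.  Split the possible values
   of the total jump size, between 0 and y s r, into finitely many bins.  On
   the bin near theta y s r, apply a Chernoff bound with the weight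
   exp(t u / r) on u <= r, for the Gaussian tilt t = (1 - theta) y / sigma^2,
   and exp(Q min(u, y s r)^(1 - eps)) on u > r, for some Q slightly below q.
   Concavity of u^(1 - eps) makes the jump weights bound the weight of the
   total jump, and the mean of the weight is
   exp((t^2 sigma^2 / 2 + o(1)) / r^2): a Taylor expansion with the moment of
   order 2 + gamma handles u <= r, the tail hypothesis handles u > r.

   Lower bound.  One term makes a jump of size theta y s r, the others are
   truncated at r and carry the rest.  The Gaussian lower bound for the
   truncated sum uses only its moment generating function: at the right tilt
   t, the tilts t + h and t - h show that sums outside a small window
   contribute negligibly to the mean of the exponential of the tilted sum. *)

Require Import Defs.
From HB Require Import structures.
From mathcomp Require Import all_boot all_order all_algebra.
From mathcomp Require Import all_classical all_reals all_analysis.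
From mathcomp Require Import measurable_realfun ring lra.

Set Implicit Arguments.
Unset Strict Implicit.
Unset Printing Implicit Defensive.

Import Order.TTheory GRing.Theory Num.Theory.
Import numFieldNormedType.Exports.
Import HBNNSimple.

Local Open Scope classical_set_scope.
Local Open Scope ring_scope.

(** * Products of functions of independent variables *)

Lemma expectationE (R : realType) (d : measure_display)
    (T : measurableType d) (P : probability T R) (f : T -> R) :
  ('E_P[f] = \int[P]_w (f w)%:E)%E.
Proof. by rewrite unlock. Qed.

(** The standard machine: simple functions increase to [g], monotone convergence passes to the limit
    on both sides, and [GA] settles each level set. In use, [G] is the product of the other factors
    and [c] its expectation. *)
Lemma integral_mul_comp (R : realType) (d : measure_display)
    (T : measurableType d) (P : probability T R) (G : T -> R)
    (X : {RV P >-> R}) (c : R) :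
  measurable_fun setT G -> (forall w, 0 <= G w) -> 0 <= c ->
  (forall A, measurable A ->
    (\int[P]_w (G w * \1_A (X w))%:E = c%:E * P (X @^-1` A))%E) ->
  forall g : R -> R, measurable_fun setT g -> (forall x, 0 <= g x) ->
  (\int[P]_w (G w * g (X w))%:E = c%:E * \int[P]_w (g (X w))%:E)%E.
Proof.
move=> mG G0 c0 GA g mg g0.
have mgE : measurable_fun setT (EFin \o g) by exact/measurable_EFinP.
pose h := nnsfun_approx measurableT mgE.
have hcvg x : (h n x)%:E @[n --> \oo] --> (g x)%:E.
  by apply: (cvg_nnsfun_approx measurableT mgE) => // y _; rewrite lee_fin.
have hnd x a b : (a <= b)%N -> h a x <= h b x.
  by move=> ab; exact/lefP/nd_nnsfun_approx.
have mhX n : measurable_fun setT (fun w => h n (X w)).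
  by apply: measurableT_comp.
have -> : (\int[P]_w (G w * g (X w))%:E)%E =
    limn (fun n => \int[P]_w (G w * h n (X w))%:E)%E.
  rewrite -monotone_convergence//.
  - apply: eq_integral => w _; apply/esym/cvg_lim => //=.
    under eq_fun do rewrite EFinM.
    by rewrite EFinM; apply: cvgeZl => //; exact: hcvg.
  - by move=> n; apply/measurable_EFinP; exact: measurable_funM.
  - by move=> n w _; rewrite lee_fin mulr_ge0.
  - by move=> w _ a b ab; rewrite lee_fin ler_wpM2l// hnd.
have -> : (\int[P]_w (g (X w))%:E)%E = limn (fun n => \int[P]_w (h n (X w))%:E)%E.
  rewrite -monotone_convergence//.
  - by apply: eq_integral => w _; apply/esym/cvg_lim => //=; exact: hcvg.
  - by move=> n; exact/measurable_EFinP.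
  - by move=> n w _; rewrite lee_fin.
  - by move=> w _ a b ab; rewrite lee_fin hnd.
rewrite -limeMl//; last first.
  apply/ereal_nondecreasing_is_cvgn => a b ab; apply: ge0_le_integral => //.
  - by move=> w _; rewrite lee_fin.
  - exact/measurable_EFinP.
  - exact/measurable_EFinP.
  - by move=> w _; rewrite lee_fin hnd.
congr (limn _); apply/funext => n /=.
have mI y : measurable (h n @^-1` [set y]) by [].
have mIX y : measurable_fun setT (fun w => \1_(h n @^-1` [set y]) (X w) : R).
  by apply: measurableT_comp => //.
transitivity (\int[P]_w \sum_(y \in range (h n))
    (G w * (y * \1_(h n @^-1` [set y]) (X w)))%:E)%E.
  apply: eq_integral => w _; rewrite fimfunE fsumEFin//; congr EFin.
  by rewrite mulr_fsumr.
rewrite ge0_integral_fsum//; last 2 first.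
  - move=> y; apply/measurable_EFinP; apply: measurable_funM => //.
    exact: measurable_funM.
  - by move=> y w _; rewrite lee_fin mulr_ge0//;
    have := nnfun_muleindic_ge0 (h n) y (X w); rewrite lee_fin.
transitivity (c%:E * \int[P]_w \sum_(y \in range (h n))
    (y * \1_(h n @^-1` [set y]) (X w))%:E)%E; last first.
  by congr (_ * _)%E; apply: eq_integral => w _; rewrite [in RHS]fimfunE fsumEFin.
rewrite ge0_integral_fsum//; last 2 first.
  - by move=> y; apply/measurable_EFinP; exact: measurable_funM.
  - by move=> y w _; have := nnfun_muleindic_ge0 (h n) y (X w); rewrite EFinM.
rewrite ge0_mule_fsumr; last first.
  move=> y; apply: integral_ge0 => w _.
  by have := nnfun_muleindic_ge0 (h n) y (X w); rewrite EFinM.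
apply: eq_fsbigr => y /[!inE] -[x _ <-].
have y0 : 0 <= h n x by [].
under eq_integral do rewrite mulrCA EFinM.
rewrite ge0_integralZl//; last 2 first.
  - by apply/measurable_EFinP; exact: measurable_funM.
  - by move=> w _; rewrite lee_fin mulr_ge0.
under [in RHS]eq_integral do rewrite EFinM.
rewrite [in RHS]ge0_integralZl//; last exact/measurable_EFinP.
rewrite GA// muleCA; congr (_ * (_ * _))%E.
rewrite (eq_integral (fun w => (\1_(X @^-1` (h n @^-1` [set h n x])) w)%:E))//.
by rewrite integral_indic ?setIT//; exact: measurable_sfunP.
Qed.

(** Induction on the number of factors that are not indicators. With none left, this is the product
    rule of [independent_RVs]; otherwise one such factor is traded for an arbitrary indicator and
    restored by [integral_mul_comp]. *)
Lemma expectation_prod_indep (R : realType) (d : measure_display)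
    (T : measurableType d) (P : probability T R) (I : finType)
    (X : I -> {RV P >-> R}) (g : I -> R -> R) (e : I -> R) :
  independent_RVs X ->
  (forall i, measurable_fun setT (g i)) -> (forall i x, 0 <= g i x) ->
  (forall i, 'E_P[g i \o X i] = (e i)%:E)%E ->
  ('E_P[fun w => (\prod_i g i (X i w))%R] = (\prod_i e i)%:E)%E.
Proof.
move=> indX; pose indicator (f : R -> R) := `[< exists2 A, measurable A & f = \1_A >].
move: {2}#|_| (leqnn #|[set i | ~~ indicator (g i)]%SET|) => n.
elim: n g e => [|n IH] g e.
  rewrite leqn0 cards_eq0 => /eqP gA mg g0 ge.
  have {}gA i : exists A, measurable A /\ g i = \1_A.
    have /negbT := finset.in_set0 i; rewrite -gA inE negbK => /asboolP[A ? ?].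
    by exists A.
  have /choice[A HA] := gA.
  have eP i : (e i)%:E = P (X i @^-1` A i).
    have mXA : measurable (X i @^-1` A i) by exact: (measurable_sfunP _ (HA i).1).
    by rewrite -ge (HA i).2 -expectation_indic.
  have := indX [set: I]%SET A (fun i _ => (HA i).1).
  under [X in _ = X -> _]eq_bigl do rewrite finset.in_setT.
  under [X in _ = X -> _]eq_bigr do rewrite -eP.
  rewrite prodEFin => <-.
  rewrite -expectation_indic; last first.
    have -> : [set w | forall i, i \in [set: I]%SET -> A i (X i w)] =
       \bigcap_(i in [set: I]) (X i @^-1` A i).
      by apply/seteqP; split => w /= H i; [move=> _|move=> _]; apply: H; rewrite ?inE.
    apply: fin_bigcap_measurable => // i _; apply: measurable_sfunP => //.
    exact: (HA i).1.
  rewrite !expectationE.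
  apply: eq_integral => w _; congr EFin; rewrite indicE.
  have [AX|/negP AX] := boolP (w \in _).
    rewrite big1// => i _; rewrite (HA i).2 indicE mem_set//.
    by move: AX; rewrite inE; apply; rewrite inE.
  have [i Ai] : exists i, ~ A i (X i w).
    by apply: contrapT => /forallNP H; apply: AX; rewrite inE => i _; apply: contrapT; exact: H.
  by rewrite (bigD1 i)//= (HA i).2 indicE memNset// mul0r.
move=> cardg mg g0 ge.
have [/eqP|] := eqVneq #|[set i | ~~ indicator (g i)]%SET| 0%N.
  by move=> g00; apply: IH => //; rewrite (eqP g00).
rewrite -lt0n card_gt0 => /set0Pn[k]; rewrite inE => gk.
rewrite (bigD1 k)//= mulrC EFinM -ge expectationE.
have mprod : measurable_fun setT (fun w => \prod_(i | i != k) g i (X i w)).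
  under eq_fun do rewrite -big_filter.
  by apply: measurable_prod => i _; exact: measurableT_comp.
have e0 i : 0 <= e i.
  by rewrite -lee_fin -ge; apply: expectation_ge0 => w; exact: g0.
rewrite [in RHS]expectationE.
transitivity (\int[P]_w ((\prod_(i | i != k) g i (X i w)) * g k (X k w))%:E)%E.
  by apply: eq_integral => w _; rewrite (bigD1 k)//= mulrC.
have -> : g k \o X k = (fun w => g k (X k w)) by [].
apply: (@integral_mul_comp _ _ _ P (fun w => \prod_(i | i != k) g i (X i w))
  (X k) (\prod_(i | i != k) e i) _ _ _ _ (g k)) => //.
- by move=> w; apply: prodr_ge0.
- by apply: prodr_ge0.
(* The family [g'] has one non-indicator fewer, so the induction hypothesis factors the expectation
   against the indicator of [A]. *)
move=> A mA; pose g' i := if i == k then \1_A else g i.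
pose e' i := if i == k then fine (P (X k @^-1` A)) else e i.
have mXA : measurable (X k @^-1` A) by exact: measurable_sfunP.
have := IH g' e'.
rewrite [X in (_ -> _ -> _ -> _ -> _ = X) -> _]/= (bigD1 k)//= /e' eqxx.
rewrite mulrC EFinM fineK ?fin_num_measure// (eq_bigr e) => [|i /negbTE->//].
move=> <-.
- rewrite expectationE; apply: eq_integral => w _; rewrite [in RHS](bigD1 k)//= /g' eqxx mulrC.
  by congr (_ * _)%:E; apply: eq_bigr => i /negbTE ->.
- rewrite -ltnS (leq_trans _ cardg)//; apply: proper_card; apply/properP; split.
    apply/fintype.subsetP => i; rewrite !inE /g'; case: ifPn => // /eqP ->.
    by rewrite gk.
  exists k; rewrite ?inE// /g' eqxx negbK; apply/asboolP; exists A => //.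
- by move=> i; rewrite /g'; case: ifP.
- by move=> i x; rewrite /g'; case: ifP.
- move=> i; rewrite /g'; case: ifPn => [/eqP ->|_]; last exact: ge.
  by rewrite -[LHS]/('E_P[\1_(X k @^-1` A)])%E expectation_indic// fineK ?fin_num_measure.
Qed.

(** * Elementary inequalities *)

Lemma mem_setb (T : Type) (p : pred T) (x : T) : (x \in [set y | p y]) = p x.
Proof. by apply/idP/idP => [/set_mem|px]; [|exact: mem_set]. Qed.

Lemma measurable_superlevel (R : realType) (d : measure_display)
    (T : measurableType d) (f : T -> R) (c : R) :
  measurable_fun setT f -> measurable [set w | c <= f w].
Proof.
move=> mf; have := measurable_fun_ler (measurable_cst c) mf.
by move=> /(_ measurableT [set true]); rewrite setTI; apply.
Qed.

Lemma measurable_superlevel_natr (R : realType) (d : measure_display)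
    (T : measurableType d) (f : T -> R) (c : R) :
  measurable_fun setT f -> measurable_fun setT (fun w => (c <= f w)%R%:R : R).
Proof.
move=> mf; rewrite (_ : (fun _ => _) = \1_[set w | c <= f w]).
  exact/measurable_indic/measurable_superlevel.
by apply/funext => w; rewrite indicE mem_setb.
Qed.

Lemma expectation_same_law (R : realType) (d d' : measure_display)
    (T : measurableType d) (T' : measurableType d')
    (P : probability T R) (P' : probability T' R)
    (X : {RV P >-> R}) (Y : {RV P' >-> R}) (g : R -> R) :
  same_law X Y -> measurable_fun setT g -> (forall x, 0 <= g x) ->
  ('E_P[g \o X] = 'E_P'[g \o Y])%E.
Proof.
move=> XY mg g0; rewrite unlock.
have mgE : measurable_fun [set: R] (EFin \o g) by exact/measurable_EFinP.
have gE0 x : (0 <= (EFin \o g) x)%E by rewrite lee_fin.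
rewrite -[LHS](ge0_integral_distribution X mgE gE0).
rewrite -[RHS](ge0_integral_distribution Y mgE gE0).
by apply: eq_measure_integral => A mA _; exact: XY.
Qed.

(** The mean value theorem gives [f u = g c * u] with [c] between [0] and [u], which gains one
    power. The bound on [g] is asked only up to [Num.max u 0], so for the exponential the constant
    depends on an upper bound of [u] alone. *)
Lemma ler_norm_derive (R : realType) (f g : R -> R) (k : nat) (C u : R) :
  f 0 = 0 -> (forall x : R, is_derive x (1 : R) f (g x)) ->
  (forall x, `|x| <= `|u| -> x <= Num.max u 0 -> `|g x| <= C * `|x| ^+ k) -> 0 <= C ->
  `|f u| <= C * `|u| ^+ k.+1.
Proof.
move=> f0 df gle C0.
have cf x y : {within `[x, y], continuous f}.
  by apply: derivable_within_continuous => z _; apply: ex_derive.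
have key c : `|c| <= `|u| -> c <= Num.max u 0 -> `|g c * u| <= C * `|u| ^+ k.+1.
  move=> cu cu'; rewrite normrM exprSr mulrA ler_wpM2r// (le_trans (gle _ cu cu'))//.
  by rewrite ler_wpM2l// lerXn2r// nnegrE.
have [u0|u0|->] := ltgtP u 0.
- have [c] := MVT u0 (fun x _ => df x) (cf _ _).
  rewrite in_itv/= f0 !sub0r => /andP[uc c0] fE.
  rewrite -normrN fE mulrN normrN key//; last by rewrite le_max (ltW c0) orbT.
  by rewrite !ltr0_norm// lerN2 ltW.
- have [c] := MVT u0 (fun x _ => df x) (cf _ _).
  rewrite in_itv/= f0 !subr0 => /andP[c0 cu] fE.
  rewrite fE key//; last by rewrite le_max (ltW cu).
  by rewrite !gtr0_norm// ltW.
- by rewrite f0 normr0 expr0n/= mulr0.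
Qed.

(** Each Taylor remainder is the derivative of the next, so [ler_norm_derive] applies three times.
    The constant stays uniform as [u] tends to minus infinity. *)
Lemma expR_taylor2 (R : realType) (t u : R) : 0 <= t -> u <= t ->
  `|expR u - (1 + u + u ^+ 2 / 2)| <= expR t * `|u| ^+ 3.
Proof.
move=> t0 ut.
have C0 : 0 <= expR t by exact: expR_ge0.
have T0 x : x <= t -> `|expR x| <= expR t * `|x| ^+ 0.
  by move=> xt; rewrite expr0 mulr1 ger0_norm ?expR_ge0// ler_expR.
have T1 x : x <= t -> `|expR x - 1| <= expR t * `|x| ^+ 1.
  move=> xt; apply: (@ler_norm_derive _ (fun y => expR y - 1) expR) => //.
  - by rewrite expR0 subrr.
  - by move=> y; apply: is_derive_eq; rewrite subr0.
  - by move=> y _ yx; apply: T0; rewrite (le_trans yx)// ge_max xt.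
have T2 x : x <= t -> `|expR x - 1 - x| <= expR t * `|x| ^+ 2.
  move=> xt; apply: (@ler_norm_derive _ (fun y => expR y - 1 - y) (fun y => expR y - 1)) => //.
  - by rewrite expR0 subrr subr0.
  - by move=> y; apply: is_derive_eq; rewrite subr0.
  - by move=> y _ yx; apply: T1; rewrite (le_trans yx)// ge_max xt.
have -> : expR u - (1 + u + u ^+ 2 / 2) = expR u - 1 - u - 2^-1 * u ^+ 2 by ring.
apply: (@ler_norm_derive _ (fun y => expR y - 1 - y - 2^-1 * y ^+ 2)
  (fun y => expR y - 1 - y)) => //.
- by rewrite expR0 subrr subr0 expr0n/= mulr0 subr0.
- move=> y; apply: is_derive_eq; rewrite subr0 /GRing.scale/=.
  by field.
- by move=> y _ yx; apply: T2; rewrite (le_trans yx)// ge_max ut.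
Qed.

Lemma quadratic_gt0 (R : realType) (u : R) : 0 < 1 + u + u ^+ 2 / 2.
Proof. nra. Qed.

(** For [|u| <= 1] the cubic remainder is below the power [2 + g <= 3]. For [|u| > 1] that power
    exceeds 1, and its multiple by [expR t] alone dominates [expR u]. *)
Lemma expR_le_taylor2 (R : realType) (t g u : R) : 0 <= t -> g <= 1 ->
  0 < g -> u <= t ->
  expR u <= 1 + u + u ^+ 2 / 2 + expR t * `|u| `^ (2 + g).
Proof.
move=> t0 g1 g0 ut.
have [u1|u1] := leP `|u| 1.
  rewrite -lerBlDl (le_trans (ler_norm _))// (le_trans (expR_taylor2 t0 ut))//.
  rewrite ler_wpM2l ?expR_ge0//.
  have [->|u0] := eqVneq `|u| 0; first by rewrite expr0n/= powR_ge0.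
  rewrite -powR_mulrn//; apply: ger_powR; last lra.
  by rewrite lt0r u0 normr_ge0.
have h : 1 <= `|u| `^ (2 + g).
  by rewrite -[leLHS](powRr0 `|u|); apply: ler_powR; [exact: ltW|lra].
have := quadratic_gt0 u; have : expR u <= expR t by rewrite ler_expR.
have := expR_gt0 t; nra.
Qed.

(** One term of the constant serves each range: [3] absorbs the quadratic when [|u| > 1], [expR t]
    is the Taylor error when [u <= t], and [3 / t ^ (2 + g)] absorbs the quadratic when
    [t < u <= 1], where the right side is 0. *)
Lemma expR_ge_taylor2 (R : realType) (t g u : R) : 0 < t -> g <= 1 -> 0 < g ->
  1 + u + u ^+ 2 / 2 - (expR t + 3 + 3 / t `^ (2 + g)) * `|u| `^ (2 + g) <=
  (if u <= t then expR u else 0).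
Proof.
move=> t0 g1 g0.
have tp : 0 < t `^ (2 + g) by rewrite powR_gt0.
have up : 0 <= `|u| `^ (2 + g) by rewrite powR_ge0.
have ep := expR_gt0 t.
have ip : 0 <= 3 / t `^ (2 + g) by rewrite divr_ge0// ltW.
have [u1|u1] := leP `|u| 1; last first.
  have h : u ^+ 2 <= `|u| `^ (2 + g).
    rewrite -real_normK ?num_real// -powR_mulrn//; apply: ler_powR; [exact: ltW|lra].
  apply: (@le_trans _ _ 0); last by case: ifP => // _; rewrite expR_ge0.
  have : 1 + u + u ^+ 2 / 2 <= 3 * u ^+ 2.
    have : 1 < u ^+ 2 by rewrite -real_normK ?num_real// exprn_egt1.
    by have := sqr_ge0 (u - 1); nra.
  nra.
have [ut|tu] := leP u t.
  have h : expR t * `|u| ^+ 3 <= expR t * `|u| `^ (2 + g).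
    rewrite ler_wpM2l ?expR_ge0//.
    have [->|u0] := eqVneq `|u| 0; first by rewrite expr0n/= powR_ge0.
    rewrite -powR_mulrn//; apply: ger_powR; last lra.
    by rewrite lt0r u0 normr_ge0.
  have := expR_taylor2 (ltW t0) ut; rewrite ler_norml => /andP[+ _].
  have := mulr_ge0 ip up; nra.
have h : 3 <= 3 / t `^ (2 + g) * `|u| `^ (2 + g).
  rewrite -mulrA ler_peMr// ler_pdivlMl ?mulr1//.
  by apply: ge0_ler_powR; rewrite ?nnegrE//;
    [lra|exact: ltW|rewrite (le_trans (ltW tu))// ler_norm].
move: u1; rewrite ler_norml => /andP[] ? ?.
have : u ^+ 2 <= 1 by nra.
nra.
Qed.

(** A fraction [z / (x + y)] in [[0, 1]] is at most its own power [a]; the fractions of [x] and [y]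
    add up to 1. *)
Lemma powR_subadd (R : realType) (a x y : R) : 0 < a -> a <= 1 ->
  0 <= x -> 0 <= y -> (x + y) `^ a <= x `^ a + y `^ a.
Proof.
move=> a0 a1 x0 y0.
have [/eqP|s0] := eqVneq (x + y) 0.
  by move/eqP ->; rewrite powR0 ?gt_eqF// addr_ge0// powR_ge0.
have sp : 0 < x + y by rewrite lt0r s0 addr_ge0.
have key z : 0 <= z -> z <= x + y -> z / (x + y) * (x + y) `^ a <= z `^ a.
  move=> z0 zs; have [->|zn0] := eqVneq z 0; first by rewrite !mul0r powR_ge0.
  have zp : 0 < z by rewrite lt0r zn0.
  have -> : z `^ a = (z / (x + y)) `^ a * (x + y) `^ a.
    by rewrite -powRM ?divr_ge0 ?ltW// divfK.
  rewrite ler_wpM2r ?powR_ge0//; apply: ger1_powR => //.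
  by rewrite divr_gt0//= ler_pdivrMr// mul1r.
have := key x x0; have := key y y0; rewrite lerDl lerDr => /(_ x0) ky /(_ y0) kx.
by apply: le_trans (lerD kx ky); rewrite -mulrDl -mulrDl divff// mul1r.
Qed.

(** * Chernoff bound with jumps, for a fixed number of terms *)

Lemma powR_min_subadd_sum (R : realType) (I : Type) (s : seq I) (p : pred I)
    (x : I -> R) (a M : R) : 0 < a -> a <= 1 -> 0 <= M ->
  (forall i, p i -> 0 <= x i) ->
  (Num.min (\sum_(i <- s | p i) x i) M) `^ a <=
  \sum_(i <- s | p i) (Num.min (x i) M) `^ a.
Proof.
move=> a0 a1 M0 x0.
suff [] : 0 <= \sum_(i <- s | p i) x i /\
  (Num.min (\sum_(i <- s | p i) x i) M) `^ a <=
  \sum_(i <- s | p i) (Num.min (x i) M) `^ a by [].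
elim/big_rec2 : _ => [|i u v pi [v0 IH]].
  by rewrite min_l// powR0// gt_eqF.
have xi0 := x0 _ pi.
split; first by rewrite addr_ge0.
have xM : 0 <= Num.min (x i) M by rewrite le_min xi0.
have vM : 0 <= Num.min v M by rewrite le_min v0.
apply: le_trans (lerD (lexx _) IH).
apply: le_trans (powR_subadd a0 a1 xM vM).
apply: ge0_ler_powR; rewrite ?nnegrE ?addr_ge0//; first exact: ltW.
  by rewrite le_min M0 addr_ge0.
have [xm|xm] := leP (x i) M; have [vm|vm] := leP v M;
  rewrite ge_min; apply/orP; first [by left; lra|by right; lra].
Qed.

(* The bin [k] collects the configurations whose jumps, i.e. the terms
   exceeding [r], add up to a total between [k M / K] and [(k + 1) M / K]. *)
Lemma jump_bin (R : realType) (I : finType) (x : I -> R) (a M r Q : R)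
    (K : nat) (lam : nat -> R) : 0 < a -> a <= 1 -> 0 < M -> 0 <= r -> 0 <= Q ->
  (0 < K)%N -> (forall k, 0 <= lam k) -> lam K = 0 -> M <= \sum_i x i ->
  exists k : 'I_K.+1,
    lam k * ((1 - k.+1%:R / K%:R) * M) + Q * (k%:R / K%:R * M) `^ a <=
    \sum_i (if x i <= r then lam k * x i else Q * (Num.min (x i) M) `^ a).
Proof.
move=> a0 a1 M0 r0 Q0 K0 lam0 lamK MS.
have K0' : 0 < K%:R :> R by rewrite ltr0n.
pose J := \sum_(i | ~~ (x i <= r)) x i.
pose W := \sum_(i | x i <= r) x i.
have SE : \sum_i x i = W + J by rewrite (bigID (fun i => x i <= r)).
have xJ i : ~~ (x i <= r) -> 0 <= x i by rewrite -ltNge => /ltW; exact: le_trans.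
have J0 : 0 <= J by exact: sumr_ge0.
(* The bulk [W] is weighted linearly; subadditivity of the capped power lets the separate jumps pay
   for their total [J]. *)
have key k : \sum_i (if x i <= r then lam k * x i else Q * (Num.min (x i) M) `^ a)
    >= lam k * W + Q * (Num.min J M) `^ a.
  rewrite (bigID (fun i => x i <= r))/= lerD//.
    rewrite mulr_sumr le_eqVlt; apply/orP; left; apply/eqP.
    by apply: eq_bigr => i ->.
  under eq_bigr => i /negbTE -> do [].
  by rewrite -mulr_sumr ler_wpM2l// powR_min_subadd_sum// ltW.
(* If the jumps alone reach [M], the last bin is used: its tilt is 0, so the bulk, which may be
   negative, does not enter. *)
have [MJ|JM] := leP M J.
  exists ord_max; apply: le_trans (key _).
  by rewrite /= lamK !mul0r !add0r min_r// divff ?mul1r// gt_eqF.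
have JK0 : 0 <= J / M * K%:R by rewrite !mulr_ge0// ?invr_ge0// ltW.
(* The lower end [k] of the bin of [J] bounds the jump cost from below; the upper end [k.+1] bounds
   from below what is left to the bulk. *)
have := Num.Theory.truncn_itv JK0; set k := Num.truncn _ => /andP[kJ Jk].
have kJ' : k%:R / K%:R * M <= J.
  by move: kJ; rewrite mulrAC ler_pdivlMr// mulrAC ler_pdivrMr.
have Jk' : J < k.+1%:R / K%:R * M.
  by move: Jk; rewrite mulrAC ltr_pdivrMr// mulrAC ltr_pdivlMr.
have kK : (k < K.+1)%N.
  rewrite ltnS -(ler_nat R) -(ler_pM2r M0) mulrC.
  apply: (@le_trans _ _ (K%:R * J)); last by rewrite ler_wpM2l// ltW.
  by move: kJ'; rewrite mulrAC ler_pdivrMr// mulrC [J * _]mulrC.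
exists (Ordinal kK); apply: le_trans (key _) => /=.
rewrite lerD//.
  rewrite ler_wpM2l// mulrBl mul1r; move: MS; rewrite SE; move: Jk'; lra.
rewrite ler_wpM2l// (min_l (ltW JM)); apply: ge0_ler_powR; rewrite ?nnegrE//; first exact: ltW.
by rewrite !mulr_ge0 ?invr_ge0// ltW.
Qed.

(** The cap at [M] lets the mean of the weight be controlled by tail bounds that are known only up
    to [M]. *)
Definition chernoff_weight (R : realType) (a M r Q l u : R) : R :=
  if u <= r then expR (l * u) else expR (Q * (Num.min u M) `^ a).

Lemma chernoff_weight_ge0 (R : realType) (a M r Q l u : R) :
  0 <= chernoff_weight a M r Q l u.
Proof. by rewrite /chernoff_weight; case: ifP => _; exact: expR_ge0. Qed.

Lemma measurable_chernoff_weight (R : realType) (a M r Q l : R) :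
  measurable_fun setT (chernoff_weight a M r Q l).
Proof.
apply: measurable_fun_ifT.
- by apply: (measurable_fun_ler (f := fun u : R => u) (g := cst r)).
- by apply: measurableT_comp => //; exact: measurable_funM.
- apply: measurableT_comp => //; apply: measurable_funM => //.
  apply: (measurableT_comp (f := @powR R ^~ a)) => //.
  by apply: (measurable_minr (f := fun u : R => u) (g := cst M)).
Qed.

(** On the event, [jump_bin] provides a bin whose normalised product of weights is at least 1, so
    the sum over all bins dominates the indicator. Independence then factors the mean of each
    product. *)
Lemma sum_tail_le (R : realType) (d : measure_display)
    (T : measurableType d) (P : probability T R) (I : finType)
    (X : I -> {RV P >-> R}) (a M r Q : R) (K : nat) (lam e : nat -> R) :
  independent_RVs X ->
  0 < a -> a <= 1 -> 0 < M -> 0 <= r -> 0 <= Q ->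
  (0 < K)%N -> (forall k, 0 <= lam k) -> lam K = 0 ->
  (forall k i, (k <= K)%N ->
    ('E_P[chernoff_weight a M r Q (lam k) \o X i] = (e k)%:E)%E) ->
  (P [set w | (M <= \sum_i X i w)%R] <=
   (\sum_(k < K.+1)
      expR (- (lam k * ((1 - k.+1%:R / K%:R) * M) + Q * (k%:R / K%:R * M) `^ a))
      * e k ^+ #|I|)%:E)%E.
Proof.
move=> indX a0 a1 M0 r0 Q0 K0 lam0 lamK eE.
pose E k := lam k * ((1 - k.+1%:R / K%:R) * M) + Q * (k%:R / K%:R * M) `^ a.
pose G k w := \prod_i chernoff_weight a M r Q (lam k) (X i w).
have mX : measurable_fun setT (fun w => \sum_i X i w) by exact: measurable_sum.
have mA : measurable [set w | M <= \sum_i X i w].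
  exact: measurable_superlevel.
have mG k : measurable_fun setT (G k).
  apply: measurable_prod => i _; apply: measurableT_comp => //.
  exact: measurable_chernoff_weight.
have G0 k w : 0 <= G k w by apply: prodr_ge0 => i _; exact: chernoff_weight_ge0.
have EG k : (k <= K)%N -> (\int[P]_w (G k w)%:E = (e k ^+ #|I|)%:E)%E.
  move=> kK; rewrite -expectationE (@expectation_prod_indep _ _ _ _ _ _
    (fun=> chernoff_weight a M r Q (lam k)) (fun=> e k))//.
  - by rewrite prodr_const.
  - by move=> i; exact: measurable_chernoff_weight.
  - by move=> i x; exact: chernoff_weight_ge0.
  - by move=> i; exact: eE.
apply: (@le_trans _ _ (\int[P]_w (\sum_(k < K.+1) expR (- E k) * G k w)%:E)%E).
  rewrite -expectation_indic// expectationE; apply: ge0_le_integral => //.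
  - exact/measurable_EFinP.
  - apply/measurable_EFinP; apply: measurable_sum => k; exact: measurable_funM.
  move=> w _; rewrite lee_fin indicE; have [|_] := boolP (w \in _); last first.
    by rewrite sumr_ge0// => k _; rewrite mulr_ge0 ?expR_ge0.
  rewrite inE/= => MS.
  have [k kE] := jump_bin (x := fun i => X i w) a0 a1 M0 r0 Q0 K0 lam0 lamK MS.
  rewrite (bigD1 k)//= -[leLHS]addr0 lerD//; last first.
    by rewrite sumr_ge0// => j _; rewrite mulr_ge0 ?expR_ge0.
  have -> : G k w = expR (\sum_i
      (if X i w <= r then lam k * X i w else Q * (Num.min (X i w) M) `^ a)).
    by rewrite expR_sum; apply: eq_bigr => i _; rewrite /chernoff_weight; case: ifP.
  by rewrite -expRD -[leLHS]expR0 ler_expR addrC subr_ge0.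
under eq_integral do rewrite -sumEFin.
rewrite ge0_integral_sum//; last 2 first.
- by move=> k; apply/measurable_EFinP; exact: measurable_funM.
- by move=> k w _; rewrite lee_fin mulr_ge0 ?expR_ge0.
rewrite -sumEFin; apply: lee_sum => k _.
under eq_integral do rewrite EFinM.
rewrite ge0_integralZl//; last 2 first.
- exact/measurable_EFinP.
- by move=> w _; rewrite lee_fin.
by rewrite EG -?EFinM// -ltnS.
Qed.

(** * Lower bound with one jump, for a fixed number of terms *)

(** It vanishes above [r], so a product of such factors is the exponential of the sum restricted to
    the event that no term exceeds [r]. *)
Definition truncated_exp (R : realType) (r l u : R) : R :=
  if u <= r then expR (l * u) else 0.

Lemma truncated_exp_ge0 (R : realType) (r l u : R) : 0 <= truncated_exp r l u.
Proof. by rewrite /truncated_exp; case: ifP => // _; exact: expR_ge0. Qed.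

Lemma measurable_truncated_exp (R : realType) (r l : R) :
  measurable_fun setT (truncated_exp r l).
Proof.
apply: measurable_fun_ifT => //.
- by apply: (measurable_fun_ler (f := fun u : R => u) (g := cst r)).
- by apply: measurableT_comp => //; exact: measurable_funM.
Qed.

Lemma prod_truncated_exp (R : realType) (I : finType) (p : pred I) (x : I -> R)
    (r l : R) :
  \prod_(i | p i) truncated_exp r l (x i) =
  if [forall (i | p i), x i <= r] then expR (l * \sum_(i | p i) x i) else 0.
Proof.
case: ifPn => [/forall_inP xr|/forall_inPn[i pi /negbTE xr]].
  by rewrite mulr_sumr expR_sum; apply: eq_bigr => i pi; rewrite /truncated_exp xr.
by rewrite (bigD1 i)//= /truncated_exp xr mul0r.
Qed.

(* Replacing the tilt [l] by [l + h] or [l - h] controls the contribution of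
   the bulk sums that fall outside [[a, b]]. *)
Lemma one_jump_tilt (R : realType) (I : finType) (i0 : I) (x : I -> R)
    (r m a b l h : R) : 0 <= l -> 0 <= h ->
  (m <= x i0)%R%:R * \prod_(i | i != i0) truncated_exp r l (x i) <=
  expR (l * b) * (m + a <= \sum_i x i)%R%:R +
  (expR (- (h * b)) *
     ((m <= x i0)%R%:R * \prod_(i | i != i0) truncated_exp r (l + h) (x i)) +
   expR (h * a) *
     ((m <= x i0)%R%:R * \prod_(i | i != i0) truncated_exp r (l - h) (x i))).
Proof.
move=> l0 h0; rewrite !prod_truncated_exp [\sum_i x i](bigD1 i0)//=.
set S := \sum_(_ | _) _.
have [mx|_] := leP m (x i0); last first.
  by rewrite !mul0r !mulr0 !addr0 mulr_ge0 ?expR_ge0.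
case: ifP => _; last by rewrite !mulr0 !addr0 mulr_ge0 ?expR_ge0.
rewrite !mul1r -!expRD.
(* Below [a], [exp (l S) <= exp (h a + (l - h) S)]; above [b],
   [exp (l S) <= exp (- h b + (l + h) S)]; in between, [exp (l S) <= exp (l b)] and the whole sum
   reaches [m + a]. *)
have [Sa|aS] := ltP S a.
  rewrite (@le_trans _ _ (expR (h * a + (l - h) * S)))//.
    by rewrite ler_expR; have := ler_wpM2l h0 (ltW Sa); lra.
  by rewrite addrA lerDr addr_ge0 ?expR_ge0// mulr_ge0 ?expR_ge0.
have [bS|Sb] := ltP b S.
  rewrite (@le_trans _ _ (expR (- (h * b) + (l + h) * S)))//.
    by rewrite ler_expR; have := ler_wpM2l h0 (ltW bS); lra.
  by rewrite addrCA lerDl addr_ge0 ?expR_ge0// mulr_ge0 ?expR_ge0.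
rewrite lerD// mulr1 (@le_trans _ _ (expR (l * b)))//.
  by rewrite ler_expR ler_wpM2l.
by rewrite lerDl addr_ge0 ?expR_ge0.
Qed.

(** This is [one_jump_tilt] integrated: by independence the term [i0] contributes [pm], and the
    other [#|I|.-1] terms contribute powers of the truncated means. *)
Lemma sum_tail_ge (R : realType) (d : measure_display)
    (T : measurableType d) (P : probability T R) (I : finType) (i0 : I)
    (X : I -> {RV P >-> R}) (r m a b l h pm e ep em : R) :
  independent_RVs X -> 0 <= l -> 0 <= h ->
  (P [set w | (m <= X i0 w)%R] = pm%:E)%E ->
  (forall i, 'E_P[truncated_exp r l \o X i] = e%:E)%E ->
  (forall i, 'E_P[truncated_exp r (l + h) \o X i] = ep%:E)%E ->
  (forall i, 'E_P[truncated_exp r (l - h) \o X i] = em%:E)%E ->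
  ((pm * (e ^+ #|I|.-1 - expR (- (h * b)) * ep ^+ #|I|.-1
          - expR (h * a) * em ^+ #|I|.-1))%:E <=
   (expR (l * b))%:E * P [set w | (m + a <= \sum_i X i w)%R])%E.
Proof.
move=> indX l0 h0 Ppm Ee Eep Eem.
have mA : measurable [set w | m + a <= \sum_i X i w].
  by apply: measurable_superlevel; exact: measurable_sum.
have mB : measurable [set x : R | m <= x] by rewrite -set_itvcy.
pose G l' w := ((m <= X i0 w)%R%:R : R) * \prod_(i | i != i0) truncated_exp r l' (X i w).
have EG l' e' : (forall i, 'E_P[truncated_exp r l' \o X i] = e'%:E)%E ->
    measurable_fun setT (G l') /\
    (\int[P]_w (G l' w)%:E = (pm * e' ^+ #|I|.-1)%:E)%E.
  (* The jump indicator becomes the factor of index [i0], so that a single product formula covers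
     jump and bulk. *)
  move=> Ee'; pose g i : R -> R := if i == i0 then \1_[set x : R | m <= x] else truncated_exp r l'.
  have GE w : G l' w = \prod_i g i (X i w).
    rewrite (bigD1 i0)//= {1}/g eqxx indicE /G; congr (_ * _).
      by congr (nat_of_bool _)%:R; rewrite mem_setb.
    by apply: eq_bigr => i /negbTE ii0; rewrite /g ii0.
  have mg i : measurable_fun setT (g i).
    by rewrite /g; case: ifP => // _; exact: measurable_truncated_exp.
  split.
    rewrite (_ : G l' = fun w => \prod_i g i (X i w)); last exact/funext.
    by apply: measurable_prod => i _; apply: measurableT_comp.
  under eq_integral do rewrite GE.
  rewrite -expectationE (@expectation_prod_indep _ _ _ _ _ _ g
    (fun i => if i == i0 then pm else e'))//.
  - rewrite (bigD1 i0)//= eqxx (eq_bigr (fun=> e')) => [|i /negbTE->//].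
    by rewrite prodr_const cardC1.
  - by move=> i x; rewrite /g; case: ifP => // _; exact: truncated_exp_ge0.
  - move=> i; rewrite /g; case: ifPn => [/eqP->|_]; last exact: Ee'.
    by rewrite -Ppm -expectation_indic//; exact: measurable_superlevel.
have G0 l' w : 0 <= G l' w.
  by rewrite mulr_ge0// prodr_ge0// => i _; exact: truncated_exp_ge0.
have [mG IG] := EG _ _ Ee; have [mGp IGp] := EG _ _ Eep; have [mGm IGm] := EG _ _ Eem.
pose F w : R := expR (- (h * b)) * G (l + h) w + expR (h * a) * G (l - h) w.
have F0 w : 0 <= F w by rewrite addr_ge0// mulr_ge0 ?expR_ge0.
have mF : measurable_fun setT F by apply: measurable_funD; exact: measurable_funM.
have IF : (\int[P]_w (F w)%:E =
    (expR (- (h * b)) * (pm * ep ^+ #|I|.-1) + expR (h * a) * (pm * em ^+ #|I|.-1))%:E)%E.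
  under eq_integral do rewrite EFinD.
  rewrite ge0_integralD//; first last.
  - by apply/measurable_EFinP; exact: measurable_funM.
  - by move=> w _; rewrite lee_fin mulr_ge0 ?expR_ge0.
  - by apply/measurable_EFinP; exact: measurable_funM.
  - by move=> w _; rewrite lee_fin mulr_ge0 ?expR_ge0.
  under eq_integral do rewrite EFinM.
  under [X in (_ + X)%E]eq_integral do rewrite EFinM.
  rewrite !ge0_integralZl// ?lee_fin ?expR_ge0//; last 4 first.
  - exact/measurable_EFinP.
  - by move=> w _; rewrite lee_fin.
  - exact/measurable_EFinP.
  - by move=> w _; rewrite lee_fin.
  by rewrite IGp IGm EFinD !EFinM.
have IA : (\int[P]_w (expR (l * b) * \1_[set w | (m + a <= \sum_i X i w)%R] w)%:E =
    (expR (l * b))%:E * P [set w | (m + a <= \sum_i X i w)%R])%E.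
  under eq_integral do rewrite EFinM.
  rewrite ge0_integralZl//; last exact/measurable_EFinP.
  by rewrite integral_indic// setIT.
suff : (\int[P]_w (G l w)%:E <=
    (expR (l * b))%:E * P [set w | (m + a <= \sum_i X i w)%R] + \int[P]_w (F w)%:E)%E.
  rewrite IG IF -leeBlDr// -EFinB; apply: le_trans.
  by rewrite lee_fin; lra.
rewrite -IA -ge0_integralD//; last 3 first.
- by apply/measurable_EFinP; exact: measurable_funM.
- by move=> w _; rewrite lee_fin.
- exact/measurable_EFinP.
apply: ge0_le_integral => //.
- by move=> w _; rewrite lee_fin.
- exact/measurable_EFinP.
- apply/measurable_EFinP; apply: measurable_funD => //; exact: measurable_funM.
move=> w _; rewrite -EFinD lee_fin indicE.
have := one_jump_tilt i0 (fun i => X i w) r m a b l0 h0.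
by rewrite mem_setb.
Qed.

(** * Moment generating function of a single term *)

(** On the geometric grid [r exp (zeta j)], capped at [M], the weight at [u] is at most the weight
    at the upper end of the cell of [u], while the indicator at the lower end equals 1. *)
Lemma expR_min_grid (R : realType) (a M r Q zeta u : R) (n : nat) :
  0 < a -> 0 < r -> 0 < M -> 0 <= Q -> (0 < n)%N ->
  M <= r * expR (zeta * n%:R) -> r <= u ->
  expR (Q * (Num.min u M) `^ a) <=
  \sum_(j < n) expR (Q * (Num.min (r * expR (zeta * j.+1%:R)) M) `^ a) *
    (Num.min (r * expR (zeta * j%:R)) M <= u)%R%:R.
Proof.
move=> a0 r0 M0 Q0 n0 Mn ru.
(* The alternative [j == n] covers points beyond the grid, where the cap at [M] bounds the
   weight. *)
have exj : exists j, (j == n) || (u < r * expR (zeta * j%:R)) by exists n; rewrite eqxx.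
case: (ex_minnP exj) => -[|j] jP jmin.
  by move: jP; rewrite mulr0 expR0 mulr1 ltNge ru orbF eq_sym gtn_eqF.
have jn : (j < n)%N by apply: jmin; rewrite eqxx.
have uj : r * expR (zeta * j%:R) <= u.
  by rewrite leNgt; apply/negP => uj; have := jmin j; rewrite uj orbT ltnn => /(_ isT).
rewrite (bigD1 (Ordinal jn))//= -[leLHS]addr0 lerD//; last first.
  by rewrite sumr_ge0// => i _; rewrite mulr_ge0 ?expR_ge0.
rewrite ge_min uj mulr1 ler_expR ler_wpM2l//.
have rj0 k : 0 < r * expR (zeta * k%:R) by rewrite mulr_gt0 ?expR_gt0.
apply: ge0_ler_powR; rewrite ?nnegrE ?le_min//.
- exact: ltW.
- by rewrite (le_trans (ltW r0) ru) ltW.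
- by rewrite !ltW.
rewrite !ge_min lexx orbT andbT.
case/orP: jP => [/eqP jE|/ltW ->//]; first by rewrite jE Mn orbT.
Qed.

(** The ratio [zeta] is tuned so that [Q exp (zeta a) = (Q + Q') / 2]. Passing from the lower to the
    upper end of a cell thus still leaves the margin [(Q' - Q) / 2] against the tail exponent [Q'],
    in each of the [n] cells. *)
Lemma expectation_grid_le (R : realType) (d : measure_display)
    (T : measurableType d) (P : probability T R) (Y : {RV P >-> R})
    (a M r Q Q' : R) (n : nat) :
  let zeta := ln ((Q + Q') / (2 * Q)) / a in
  0 < a -> 0 < r -> r <= M -> 0 < Q -> Q < Q' ->
  (forall u : R, r <= u -> u <= M -> (P [set w | (u <= Y w)%R] <= (expR (- (Q' * u `^ a)))%:E)%E) ->
  (\int[P]_w (\sum_(j < n) expR (Q * (Num.min (r * expR (zeta * j.+1%:R)) M) `^ a) *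
    (Num.min (r * expR (zeta * j%:R)) M <= Y w)%R%:R)%:E <=
  (n%:R * expR (- ((Q' - Q) / 2 * r `^ a)))%:E)%E.
Proof.
move=> zeta a0 r0 rM Q0 QQ' tailY.
have z0 : 0 <= zeta.
  rewrite divr_ge0 ?(ltW a0)// ln_ge0// ler_pdivlMr ?mul1r//; last lra.
  lra.
have Qz : Q * expR (zeta * a) = (Q + Q') / 2.
  rewrite divfK ?gt_eqF// lnK; last by rewrite posrE divr_gt0//; lra.
  by field; rewrite gt_eqF.
have mle c : measurable [set w | c <= Y w] by exact: measurable_superlevel.
have mI c : measurable_fun setT (fun w => (c <= Y w)%R%:R : R).
  exact: measurable_superlevel_natr.
under eq_integral do rewrite -sumEFin.
rewrite ge0_integral_sum//; last first.
  by move=> j; apply/measurable_EFinP; exact: measurable_funM.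
rewrite mulr_natl -[n in leRHS]card_ord -sumr_const -sumEFin; apply: lee_sum => j _.
set u := Num.min (r * expR (zeta * j%:R)) M.
under eq_integral do rewrite EFinM.
rewrite ge0_integralZl//; last exact/measurable_EFinP.
rewrite (eq_integral (fun w => (\1_[set w | u <= Y w] w)%:E)); last first.
  by move=> w _; rewrite indicE mem_setb.
rewrite integral_indic// setIT.
have ru : r <= u.
  rewrite le_min rM andbT ler_peMr ?(ltW r0)// -expR0 ler_expR mulr_ge0//.
have uM : u <= M by rewrite ge_min lexx orbT.
have u0 : 0 < u by exact: lt_le_trans ru.
apply: (@le_trans _ _ ((expR (Q * (Num.min (r * expR (zeta * j.+1%:R)) M) `^ a))%:E *
   (expR (- (Q' * u `^ a)))%:E)%E).
  by rewrite lee_wpmul2l ?lee_fin ?expR_ge0//; exact: tailY.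
rewrite -EFinM lee_fin -expRD ler_expR.
have u1 : Num.min (r * expR (zeta * j.+1%:R)) M <= u * expR zeta.
  rewrite /u ge_min; apply/orP; have [_|_] := leP _ M; [left|right].
    by rewrite -[leRHS]mulrA -expRD -natr1 mulrDr mulr1.
  by rewrite ler_peMr// ?(le_trans (ltW r0) rM)// -expR0 ler_expR.
have u2 : (Num.min (r * expR (zeta * j.+1%:R)) M) `^ a <= u `^ a * expR (zeta * a).
  rewrite (expRM zeta a) -powRM ?expR_ge0 ?(ltW u0)//.
  apply: ge0_ler_powR; rewrite ?nnegrE ?(ltW a0)//.
    by rewrite le_min mulr_ge0 ?expR_ge0 ?(ltW r0)//= (le_trans (ltW r0) rM).
  by rewrite mulr_ge0 ?expR_ge0 ?(ltW u0).
have u3 : r `^ a <= u `^ a by apply: ge0_ler_powR => //; rewrite ?nnegrE; exact: ltW.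
have u4 : Q * (Num.min (r * expR (zeta * j.+1%:R)) M) `^ a <= u `^ a * ((Q + Q') / 2).
  by rewrite -Qz mulrCA ler_pM2l.
have : (Q' - Q) / 2 * r `^ a <= (Q' - Q) / 2 * u `^ a.
  by rewrite ler_wpM2l// divr_ge0// subr_ge0 ltW.
by clear - u4; move: u4; set p := Num.min _ _ `^ a; lra.
Qed.

Section moments.
Context (R : realType) (d : measure_display) (T : measurableType d)
  (P : probability T R) (Y : {RV P >-> R}) (v w g : R)
  (intY : P.-integrable setT (fun x => (Y x)%:E))
  (EY : ('E_P[Y] = 0)%E)
  (EY2 : ('E_P[fun x => (Y x ^+ 2)%R] = v%:E)%E)
  (EYg : ('E_P[fun x => (`|Y x| `^ (2 + g))%R] = w%:E)%E).

Lemma expectation_quadratic (l : R) :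
  (\int[P]_x (1 + l * Y x + (l * Y x) ^+ 2 / 2)%:E = (1 + l ^+ 2 * v / 2)%:E)%E.
Proof.
have int1 : P.-integrable setT (fun=> 1%:E).
  exact: finite_measure_integrable_cst.
have int2 : P.-integrable setT (fun x => (Y x ^+ 2)%:E).
  apply/integrableP; split; first by apply/measurable_EFinP; exact: measurable_funX.
  under eq_integral do rewrite /= ger0_norm ?sqr_ge0//.
  by rewrite -expectationE EY2 ltry.
under eq_integral => x _.
  rewrite (_ : 1 + l * Y x + (l * Y x) ^+ 2 / 2 =
    1 + (l * Y x + l ^+ 2 / 2 * Y x ^+ 2)); last by ring.
  rewrite EFinD (EFinD (l * Y x)) (EFinM l) (EFinM (l ^+ 2 / 2)); over.
have intl : P.-integrable setT (fun x => (l%:E * (Y x)%:E)%E) by exact: integrableZl.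
have intl2 : P.-integrable setT (fun x => ((l ^+ 2 / 2)%:E * (Y x ^+ 2)%:E)%E).
  exact: integrableZl.
rewrite integralD//; last exact: integrableD.
rewrite integralD// !integralZl// -!expectationE EY EY2 expectation_cst.
by rewrite mule0 add0e -EFinM -EFinD mulrAC.
Qed.

Lemma expectation_powR (l : R) : 0 <= l ->
  (\int[P]_x (`|l * Y x| `^ (2 + g))%:E = (l `^ (2 + g) * w)%:E)%E.
Proof.
move=> l0; under eq_integral do rewrite normrM powRM// (ger0_norm l0) EFinM.
rewrite ge0_integralZl ?lee_fin ?powR_ge0// -?expectationE ?EYg//.
apply/measurable_EFinP; apply: (measurableT_comp (f := @powR R ^~ (2 + g))) => //.
exact: measurableT_comp.
Qed.

Let mpow l : measurable_fun setT (fun x => `|l * Y x| `^ (2 + g)).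
Proof.
apply: (measurableT_comp (f := @powR R ^~ (2 + g))) => //.
by apply: measurableT_comp => //; exact: measurable_funM.
Qed.

Let mquad l : measurable_fun setT (fun x => 1 + l * Y x + (l * Y x) ^+ 2 / 2).
Proof.
apply: measurable_funD; first by apply: measurable_funD => //; exact: measurable_funM.
by apply: measurable_funM => //; apply: measurable_funX; exact: measurable_funM.
Qed.

(** Below [r] the Taylor bound applies to [(t / r) Y <= t]; above [r] the grid bound applies. All
    three bounding functions are nonnegative, so their sum dominates the weight everywhere. *)
Lemma expectation_chernoff_weight_le (a M r Q Q' t : R) (n : nat) :
  0 < g -> g <= 1 ->
  0 < a -> 0 < r -> r <= M -> 0 < Q -> Q < Q' -> (0 < n)%N -> 0 <= t ->
  M <= r * expR (ln ((Q + Q') / (2 * Q)) / a * n%:R) ->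
  (forall u : R, r <= u -> u <= M -> (P [set w | (u <= Y w)%R] <= (expR (- (Q' * u `^ a)))%:E)%E) ->
  ('E_P[chernoff_weight a M r Q (t / r) \o Y] <=
   (1 + (t / r) ^+ 2 * v / 2 + expR t * ((t / r) `^ (2 + g) * w) +
    n%:R * expR (- ((Q' - Q) / 2 * r `^ a)))%:E)%E.
Proof.
move=> g0 g1 a0 r0 rM Q0 QQ' n0 t0 Mn tailY.
have l0 : 0 <= t / r by rewrite divr_ge0// ltW.
set zeta := ln _ / a in Mn.
pose D x : R := \sum_(j < n) expR (Q * (Num.min (r * expR (zeta * j.+1%:R)) M) `^ a) *
    (Num.min (r * expR (zeta * j%:R)) M <= Y x)%R%:R.
have mD : measurable_fun setT D.
  apply: measurable_sum => j; apply: measurable_funM => //.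
  exact: measurable_superlevel_natr.
have D0 x : 0 <= D x by apply: sumr_ge0 => j _; rewrite mulr_ge0 ?expR_ge0.
pose q x := 1 + t / r * Y x + (t / r * Y x) ^+ 2 / 2.
have q0 x : 0 <= q x by apply/ltW/quadratic_gt0.
pose p x := `|t / r * Y x| `^ (2 + g).
have p0 x : 0 <= p x by exact: powR_ge0.
have -> : (1 + (t / r) ^+ 2 * v / 2 + expR t * ((t / r) `^ (2 + g) * w) +
    n%:R * expR (- ((Q' - Q) / 2 * r `^ a)))%:E =
  (\int[P]_x (q x)%:E + (expR t)%:E * \int[P]_x (p x)%:E +
   (n%:R * expR (- ((Q' - Q) / 2 * r `^ a)))%:E)%E.
  by rewrite expectation_quadratic expectation_powR// -EFinM -!EFinD.
apply: (@le_trans _ _ (\int[P]_x (q x)%:E +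
    (expR t)%:E * \int[P]_x (p x)%:E + \int[P]_x (D x)%:E)%E); last first.
  by rewrite leeD2l//; exact: expectation_grid_le.
have mp : measurable_fun setT (EFin \o p) by apply/measurable_EFinP; exact: mpow.
have mq : measurable_fun setT (EFin \o q) by apply/measurable_EFinP; exact: mquad.
rewrite -ge0_integralZl ?lee_fin ?expR_ge0//; last by move=> x _; rewrite lee_fin.
rewrite -ge0_integralD//; last 3 first.
- by move=> x _; rewrite lee_fin.
- by move=> x _; rewrite -EFinM lee_fin mulr_ge0 ?expR_ge0.
- under eq_fun do rewrite -EFinM; apply/measurable_EFinP.
  by apply: measurable_funM => //; exact: mpow.
rewrite -ge0_integralD//; last 4 first.
- by move=> x _; rewrite -EFinM -EFinD lee_fin addr_ge0// mulr_ge0 ?expR_ge0.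
- under eq_fun do rewrite -EFinM -EFinD; apply/measurable_EFinP.
  by apply: measurable_funD; [exact: mquad|apply: measurable_funM => //; exact: mpow].
- by move=> x _; rewrite lee_fin.
- exact/measurable_EFinP.
rewrite expectationE; apply: ge0_le_integral => //.
- by move=> x _; rewrite lee_fin chernoff_weight_ge0.
- apply/measurable_EFinP; apply: measurableT_comp => //.
  exact: measurable_chernoff_weight.
- under eq_fun do rewrite -EFinM -!EFinD; apply/measurable_EFinP.
  apply: measurable_funD => //; apply: measurable_funD; [exact: mquad|].
  by apply: measurable_funM => //; exact: mpow.
move=> x _; rewrite -EFinM -!EFinD lee_fin /= /chernoff_weight.
case: ifPn => [Yr|]; last first.
  rewrite -ltNge => /ltW rY.
  rewrite (le_trans (expR_min_grid a0 r0 (lt_le_trans r0 rM) (ltW Q0) n0 Mn rY))//.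
  by rewrite lerDr addr_ge0// mulr_ge0 ?expR_ge0.
rewrite (le_trans (@expR_le_taylor2 _ t g _ t0 g1 g0 _)) ?lerDl//.
by rewrite mulrAC ler_pdivrMr// ler_wpM2l.
Qed.

(** With [u = (t / r) Y], the cutoff [u <= t] of [expR_ge_taylor2] is exactly [Y <= r]. The error
    term is moved to the other side so that only nonnegative functions are integrated. *)
Lemma expectation_truncated_exp_ge (r t : R) :
  0 < g -> g <= 1 -> 0 < r -> 0 < t ->
  ((1 + (t / r) ^+ 2 * v / 2
    - (expR t + 3 + 3 / t `^ (2 + g)) * ((t / r) `^ (2 + g) * w))%:E <=
   'E_P[truncated_exp r (t / r) \o Y])%E.
Proof.
move=> g0 g1 r0 t0.
have l0 : 0 < t / r by rewrite divr_gt0.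
set C := _ + 3 / _.
have C0 : 0 <= C by rewrite !addr_ge0 ?expR_ge0 ?divr_ge0 ?powR_ge0.
rewrite EFinB -expectation_quadratic leeBlDr//.
rewrite EFinM -expectation_powR ?(ltW l0)// -ge0_integralZl ?lee_fin//; last first.
  by apply/measurable_EFinP; exact: mpow.
have mt : measurable_fun setT (truncated_exp r (t / r) \o Y).
  by apply: measurableT_comp => //; exact: measurable_truncated_exp.
rewrite expectationE -ge0_integralD//; last 4 first.
- by move=> x _; rewrite lee_fin truncated_exp_ge0.
- exact/measurable_EFinP.
- by move=> x _; rewrite -EFinM lee_fin mulr_ge0// powR_ge0.
- under eq_fun do rewrite -EFinM; apply/measurable_EFinP.
  by apply: measurable_funM => //; exact: mpow.
apply: ge0_le_integral => //.
- by move=> x _; rewrite lee_fin ltW// quadratic_gt0.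
- by apply/measurable_EFinP; exact: mquad.
- under eq_fun do rewrite -EFinM -EFinD; apply/measurable_EFinP.
  by apply: measurable_funD => //; apply: measurable_funM => //; exact: mpow.
move=> x _; rewrite -EFinM -EFinD lee_fin -lerBlDr /= /truncated_exp.
have := expR_ge_taylor2 (t / r * Y x) t0 g1 g0.
by rewrite mulrAC ler_pdivrMr// ler_pM2l// mulrAC.
Qed.

End moments.

(** * Limits of real sequences *)

Lemma dominated_bound (R : realType) (x y : nat -> R) (C : R) :
  (\forall n \near \oo, `|x n / y n| <= C) -> dominated x y.
Proof.
move=> xyC; apply: (@le_lt_trans _ _ C%:E); last exact: ltry.
apply: ereal_inf_le; exists (ereal_sup [set (`|x n / y n|)%:E | n in [set n | `|x n / y n| <= C]]).
  by exists [set n | `|x n / y n| <= C].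
by apply: ge_ereal_sup => _ [n xyn <-]; rewrite lee_fin.
Qed.

Lemma lne_ratio_lt (R : realType) (p : \bar R) (b c : R) :
  p \is a fin_num -> b < 0 -> (c%:E < lne p / b%:E)%E -> (p <= (expR (c * b))%:E)%E.
Proof.
case: p => // p _ b0; rewrite lee_fin.
have [p0 _|p0] := leP p 0; first by rewrite (le_trans p0) ?expR_ge0.
rewrite lne_EFin// inver lt_eqF// -EFinM lte_fin ltr_ndivlMr// => /ltW.
by rewrite -ler_expR lnK.
Qed.

(** A null [p] is excluded: its logarithm divided by the negative [b] would be [+oo]. *)
Lemma lne_ratio_gt (R : realType) (p : \bar R) (b c : R) :
  p \is a fin_num -> b < 0 -> (lne p / b%:E < c%:E)%E -> ((expR (c * b))%:E <= p)%E.
Proof.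
case: p => // p _ b0; rewrite lee_fin inver lt_eqF//.
have [p0|p0] := leP p 0.
  by rewrite le0_lneNy ?lee_fin// lt0_mulNye// lte_fin invr_lt0.
rewrite lne_EFin// -EFinM lte_fin ltr_ndivrMr// => /ltW.
by rewrite -ler_expR lnK.
Qed.

(** Apply [1 + x <= exp x] at [x = - z / (1 + z)], where [1 + x] is the inverse of [1 + z], and
    invert. *)
Lemma expR_le_quot (R : realType) (z : R) : -1 < z -> expR (z / (1 + z)) <= 1 + z.
Proof.
move=> z1; have z0 : 0 < 1 + z by lra.
rewrite -[leLHS]invrK -expRN -[leRHS]invrK.
rewrite lef_pV2 ?posrE ?invr_gt0 ?expR_gt0//.
apply: le_trans (expR_ge1Dx _).
by rewrite le_eqVlt; apply/orP; left; apply/eqP; field; rewrite gt_eqF.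
Qed.

(** By [expR_le_quot], [1 + A / x >= exp (A / (x + A))]. Replacing [x + A] by [x] in the exponent
    changes it by [A ^ 2 / (x (x + A))], at most [eta / (2 x)] beyond the threshold. *)
Lemma expR_le1D_shift (R : realType) (A eta x : R) : 0 < eta ->
  2 * A ^+ 2 / eta + `|A| + 1 <= x -> expR ((A - eta / 2) / x) <= 1 + A / x.
Proof.
move=> eta0 Ax.
have A0 : 0 <= 2 * A ^+ 2 / eta.
  by apply: divr_ge0; [rewrite mulr_ge0 ?sqr_ge0|exact: ltW].
have nA := ler_norm A; have nA' : - A <= `|A| by rewrite ler_normr lexx orbT.
have x0 : 0 < x by have := normr_ge0 A; lra.
have xA : 0 < x + A by lra.
have z1 : -1 < A / x by rewrite ltr_pdivlMr//; lra.
apply: le_trans (expR_le_quot z1); rewrite ler_expR.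
have -> : A / x / (1 + A / x) = A / (x + A).
  by field; rewrite !gt_eqF//; lra.
rewrite ler_pdivrMr// mulrAC ler_pdivlMr//.
have h : 2 * A ^+ 2 <= eta * (x - `|A| - 1).
  by rewrite [leRHS]mulrC -ler_pdivrMr//; lra.
have := normr_ge0 A; nra.
Qed.

(** With [z = r ^ a] and [p <= m a], the power of [r] is at most [z ^ m], while [exp (c z)] exceeds
    its Taylor term of order [m + 1]; the quotient is of order [1 / z]. *)
Lemma powR_expR_small (R : realType) (r : nat -> R) (p a c eta : R) :
  r n @[n --> \oo] --> +oo -> 0 < a -> 0 < c -> 0 < eta ->
  \forall n \near \oo, r n `^ p * expR (- (c * r n `^ a)) <= eta.
Proof.
move=> /cvgryPge rinf a0 c0 eta0.
have [m pm] : exists m : nat, p <= m%:R * a.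
  have [p0|p0] := leP p 0; first by exists 0%N; rewrite mul0r.
  exists (Num.truncn (p / a)).+1; rewrite -ler_pdivrMr// ltW//.
  by have /Num.Theory.truncn_itv /andP[] : 0 <= p / a by rewrite divr_ge0// ltW.
pose C := m.+1`!%:R / (c ^+ m.+1 * eta).
have C0 : 0 <= C by rewrite divr_ge0// mulr_ge0 ?exprn_ge0// ltW.
near=> n.
have r1 : 1 <= r n by near: n; exact: rinf.
have rC : (C + 1) `^ a^-1 <= r n by near: n; exact: rinf.
have r0 : 0 < r n by lra.
pose z := r n `^ a.
have zC : C <= z.
  rewrite (@le_trans _ _ (C + 1)) ?lerDl//.
  have -> : C + 1 = ((C + 1) `^ a^-1) `^ a by rewrite -powRrM mulVf ?gt_eqF// powRr1// addr_ge0.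
  by apply: ge0_ler_powR; rewrite ?nnegrE ?powR_ge0// ltW.
have z0 : 0 < z by exact: powR_gt0.
have rpz : r n `^ p <= z ^+ m.
  rewrite -powR_mulrn ?(ltW z0)// /z -powRrM mulrC; exact: ler_powR.
rewrite -/z (le_trans (ler_wpM2r (expR_ge0 _) rpz))//.
rewrite expRN ler_pdivrMr ?expR_gt0//.
have cz0 : 0 <= c * z by rewrite mulr_ge0 ?ltW.
apply: (@le_trans _ _ (eta * ((c * z) ^+ m.+1 / m.+1`!%:R))); last first.
  rewrite ler_wpM2l ?(ltW eta0)//; have := expR_ge1Dxn m cz0; lra.
have f0 : 0 < m.+1`!%:R :> R by rewrite ltr0n fact_gt0.
rewrite mulrA ler_pdivlMr// mulrC.
have zm : 0 <= z ^+ m by rewrite exprn_ge0// ltW.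
have h : m.+1`!%:R <= z * (c ^+ m.+1 * eta).
  by rewrite -ler_pdivrMr// mulr_gt0// exprn_gt0.
rewrite [leRHS](_ : _ = z * (c ^+ m.+1 * eta) * z ^+ m); last first.
  by rewrite exprMn [z ^+ m.+1]exprS; ring.
by rewrite ler_wpM2r.
Unshelve. all: by end_near. Qed.

(** * Large deviations for the triangular array *)

Section triangular_array.
Context (R : realType) (d : measure_display)
  (Omega : measurableType d) (P : probability Omega R)
  (Y : nat -> {RV P >-> R}) (N : nat -> nat)
  (Yrow : forall n : nat, 'I_(N n) -> {RV P >-> R})
  (Y_integrable : forall n, (0 < n)%N ->
     P.-integrable setT (fun w => (Y n w)%:E))
  (Y_centered : forall n, (0 < n)%N -> ('E_P[Y n] = 0)%E)
  (N_pos : forall n, (0 < n)%N -> (1 <= N n)%N)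
  (N_cvg : N n @[n --> \oo] --> \oo)
  (Yrow_indep : forall n, (0 < n)%N -> independent_RVs (Yrow n))
  (Yrow_law : forall n, (0 < n)%N ->
     forall i : 'I_(N n), same_law (Yrow n i) (Y n))
  (eps q sigma alpha : R)
  (eps_gt0 : 0 < eps) (eps_lt1 : eps < 1)
  (q_gt0 : 0 < q) (sigma_gt0 : 0 < sigma)
  (alphaE : alpha = (1 + eps)^-1)
  (tail : forall y : nat -> R,
     (forall n, (0 < n)%N -> 0 < y n) ->
     dominated (fun n => (N n)%:R `^ (alpha * eps)) y ->
     dominated y (fun n => (N n)%:R `^ alpha) ->
     asymp_equiv (fun n => lne (P [set w | y n <= Y n w]))
                 (fun n => - q * y n `^ (1 - eps)))
  (second_moment :
     'E_P[fun w => (Y n w ^+ 2)%R]%E @[n --> \oo] --> (sigma ^+ 2)%:E)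
  (gamma : R) (gamma_gt0 : 0 < gamma) (gamma_le1 : gamma <= 1)
  (higher_moment :
     asymp_negligible (fun n => 'E_P[fun w => (`|Y n w| `^ (2 + gamma))%R]%E)
                      (fun n => (N n)%:R `^ (gamma * (1 - alpha)))).

Arguments Yrow : clear implicits.

(* With these normalisations [N = s r ^ 2] and [N ^ alpha = s r]: [r] is the
   truncation level and [s] the speed of the large deviation principle. *)
Let r n : R := (N n)%:R `^ (alpha * eps).
Let s n : R := (N n)%:R `^ (alpha * (1 - eps)).

Let alpha_gt0 : 0 < alpha.
Proof. by rewrite alphaE invr_gt0 addr_gt0. Qed.

Let alphaD : alpha + alpha * eps = 1.
Proof. by rewrite alphaE; field; rewrite gt_eqF// addr_gt0. Qed.

Let n_gt0 : \forall n \near \oo, (0 < n)%N.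
Proof. exact: nbhs_infty_gt. Qed.

Let N_ge1 n : (0 < n)%N -> 1 <= (N n)%:R :> R.
Proof. by move=> /N_pos; rewrite ler1n. Qed.

Let N_neq0 n : (0 < n)%N -> (N n)%:R != 0 :> R.
Proof. by move=> /N_ge1 h; rewrite gt_eqF//; lra. Qed.

Let powN_ge1 n (x : R) : (0 < n)%N -> 0 <= x -> 1 <= (N n)%:R `^ x.
Proof.
move=> n0 x0; rewrite -[leLHS](powRr0 ((N n)%:R : R)); apply: ler_powR => //.
exact: N_ge1.
Qed.

Let r_ge1 n : (0 < n)%N -> 1 <= r n.
Proof. by move=> n0; apply: powN_ge1 => //; rewrite mulr_ge0// ltW. Qed.

Let s_ge1 n : (0 < n)%N -> 1 <= s n.
Proof. by move=> n0; apply: powN_ge1 => //; rewrite mulr_ge0// ?ltW// subr_gt0. Qed.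

Let r_gt0 n : (0 < n)%N -> 0 < r n.
Proof. by move=> /r_ge1; lra. Qed.

Let s_gt0 n : (0 < n)%N -> 0 < s n.
Proof. by move=> /s_ge1; lra. Qed.

Let NE n : (0 < n)%N -> (N n)%:R = s n * r n ^+ 2.
Proof.
move=> n0; rewrite -powR_mulrn ?powR_ge0// /r /s -powRrM -powRD; last first.
  by rewrite N_neq0// implybT.
rewrite (_ : alpha * (1 - eps) + alpha * eps * 2%:R = 1) ?powRr1//.
by move: alphaD; lra.
Qed.

Let powNalpha n : (0 < n)%N -> (N n)%:R `^ alpha = s n * r n.
Proof.
move=> n0; rewrite /r /s -powRD; last by rewrite N_neq0// implybT.
by congr (_ `^ _); ring.
Qed.

(** As [(s r) ^ (1 - eps) = N ^ (alpha (1 - eps)) = s], jumps of order [s r] have a cost of the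
    order of the speed. *)
Let powsr n (u : R) : (0 < n)%N -> 0 <= u ->
  (u * (s n * r n)) `^ (1 - eps) = u `^ (1 - eps) * s n.
Proof.
by move=> n0 u0; rewrite powRM// -powNalpha// -?powRrM// powR_ge0.
Qed.

Let powr_gamma n : (N n)%:R `^ (gamma * (1 - alpha)) = r n `^ gamma.
Proof.
rewrite /r -powRrM; congr (_ `^ _).
by rewrite mulrC (_ : 1 - alpha = alpha * eps)//; move: alphaD; lra.
Qed.

Let powN_cvgy (x : R) : 0 < x -> ((N n)%:R `^ x : R) @[n --> \oo] --> +oo.
Proof.
move=> x0; apply/cvgryPge => A.
have /cvgryPge/(_ (`|A| `^ x^-1)) : ((N n)%:R : R) @[n --> \oo] --> +oo by exact/cvgrnyP.
apply: filterS => n h; apply: (le_trans (ler_norm A)).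
have -> : `|A| = (`|A| `^ x^-1) `^ x by rewrite -powRrM mulVf ?gt_eqF// powRr1.
by apply: ge0_ler_powR => //; rewrite ?nnegrE ?powR_ge0// ltW.
Qed.

Let r_cvgy : r n @[n --> \oo] --> +oo.
Proof. by apply: powN_cvgy; rewrite mulr_gt0. Qed.

Let s_cvgy : s n @[n --> \oo] --> +oo.
Proof. by apply: powN_cvgy; rewrite mulr_gt0// subr_gt0. Qed.

Let r_ge A : \forall n \near \oo, A <= r n.
Proof. by move/cvgryPge : r_cvgy; apply. Qed.

Let s_ge A : \forall n \near \oo, A <= s n.
Proof. by move/cvgryPge : s_cvgy; apply. Qed.

(** * Tail estimates in terms of [r] and [s] *)

Let prob_fin n u : P [set w | u <= Y n w] \is a fin_num.
Proof. by apply: fin_num_measure; exact: measurable_superlevel. Qed.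

(** Thresholds between [r] and a multiple of [s r] satisfy both domination conditions; the
    convergence of the ratio to 1 is then read within [delta]. *)
Let tail_ratio (y : nat -> R) (C delta : R) : 0 < delta ->
  (forall n, (0 < n)%N -> 0 < y n) ->
  (\forall n \near \oo, r n <= y n /\ y n <= C * (s n * r n)) ->
  \forall n \near \oo,
   (((1 - delta)%:E < lne (P [set w | (y n <= Y n w)%R]) / (- q * y n `^ (1 - eps))%:E) /\
   (lne (P [set w | (y n <= Y n w)%R]) / (- q * y n `^ (1 - eps))%:E < (1 + delta)%:E))%E.
Proof.
move=> delta0 y0 ybd.
have dom1 : dominated (fun n => (N n)%:R `^ (alpha * eps)) y.
  apply: (@dominated_bound _ _ _ 1); near=> n.
  have n0 : (0 < n)%N by near: n.
  have [ry _] : r n <= y n /\ y n <= C * (s n * r n) by near: n.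
  rewrite ger0_norm ?divr_ge0 ?powR_ge0// ?(ltW (y0 _ n0))//.
  by rewrite ler_pdivrMr ?y0// mul1r.
have dom2 : dominated y (fun n => (N n)%:R `^ alpha).
  apply: (@dominated_bound _ _ _ C); near=> n.
  have n0 : (0 < n)%N by near: n.
  have [_ yC] : r n <= y n /\ y n <= C * (s n * r n) by near: n.
  rewrite ger0_norm ?divr_ge0 ?powR_ge0// ?(ltW (y0 _ n0))//.
  by rewrite powNalpha// ler_pdivrMr// mulr_gt0// ?s_gt0// r_gt0.
have /fine_cvgP[finr /cvgrPdist_lt/(_ _ delta0) cvr] := tail y0 dom1 dom2.
near=> n.
have fr : (lne (P [set w | (y n <= Y n w)%R]) / (- q * y n `^ (1 - eps))%:E)%E \is a fin_num.
  by near: n.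
have : `|1 - fine (lne (P [set w | (y n <= Y n w)%R]) / (- q * y n `^ (1 - eps))%:E)%E| < delta.
  by near: n; exact: cvr.
rewrite -(fineK fr) !lte_fin ltr_norml => /andP[].
by move=> h1 h2; split; lra.
Unshelve. all: by end_near. Qed.

(* Applying the tail hypothesis to a sequence of worst thresholds makes it
   uniform over the whole range. *)
Let tail_le (y delta : R) : 0 < y -> 0 < delta ->
  \forall n \near \oo, forall u : R, r n <= u -> u <= y * (s n * r n) ->
    (P [set w | (u <= Y n w)%R] <= (expR (- ((1 - delta) * q * u `^ (1 - eps))))%:E)%E.
Proof.
move=> y0 delta0.
pose bad n u := [/\ r n <= u, u <= y * (s n * r n) &
  ~ (P [set w | (u <= Y n w)%R] <= (expR (- ((1 - delta) * q * u `^ (1 - eps))))%:E)%E].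
(* When no threshold is bad, the default [r n] keeps the sequence in the admissible range; hence the
   constant [Num.max y 1] below. *)
have /choice[u uP] : forall n, exists u, (bad n u) \/ ((forall u', ~ bad n u') /\ u = r n).
  move=> n; have [[u bu]|nb] := pselect (exists u, bad n u); first by exists u; left.
  by exists (r n); right; split => // u' bu; apply: nb; exists u'.
have u_gt0 n : (0 < n)%N -> 0 < u n.
  move=> n0; have [[ru _ _]|[_ ->]] := uP n; last exact: r_gt0.
  by apply: lt_le_trans ru; exact: r_gt0.
have bd : \forall n \near \oo, r n <= u n /\ u n <= Num.max y 1 * (s n * r n).
  near=> n; have n0 : (0 < n)%N by near: n.
  have sr0 : 0 < s n * r n by rewrite mulr_gt0// ?s_gt0// r_gt0.
  have [[ru uy _]|[_ ->]] := uP n; split => //.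
    by rewrite (le_trans uy)// ler_pM2r// le_max lexx.
  rewrite (@le_trans _ _ (1 * (s n * r n)))//.
    by rewrite mul1r ler_peMl ?s_ge1// ltW// r_gt0.
  by rewrite ler_pM2r// le_max lexx orbT.
have h := tail_ratio delta0 u_gt0 bd.
near=> n => v rv vy; apply: contrapT => nv.
have n0 : (0 < n)%N by near: n.
have [[ru uy]|[/(_ v) nb _]] := uP n; last by apply: nb; split.
apply.
have [+ _] : ((1 - delta)%:E < lne (P [set w | (u n <= Y n w)%R]) / (- q * u n `^ (1 - eps))%:E /\
   lne (P [set w | (u n <= Y n w)%R]) / (- q * u n `^ (1 - eps))%:E < (1 + delta)%:E)%E.
  by near: n; exact: h.
move=> lt1; rewrite -mulrA -mulrN -mulNr; apply: lne_ratio_lt => //.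
by rewrite mulNr oppr_lt0 mulr_gt0// powR_gt0// u_gt0.
Unshelve. all: by end_near. Qed.

Let tail_ge (u delta : R) : 0 < u -> 0 < delta ->
  \forall n \near \oo,
    ((expR (- ((1 + delta) * q * (u `^ (1 - eps) * s n))))%:E <=
     P [set w | (u * (s n * r n) <= Y n w)%R])%E.
Proof.
move=> u0 delta0.
have y0 n : (0 < n)%N -> 0 < u * (s n * r n).
  by move=> n0; rewrite !mulr_gt0// ?s_gt0// r_gt0.
have bd : \forall n \near \oo, r n <= u * (s n * r n) /\ u * (s n * r n) <= u * (s n * r n).
  near=> n; have n0 : (0 < n)%N by near: n.
  split => //; rewrite mulrA ler_peMl ?(ltW (r_gt0 n0))// mulrC -ler_pdivrMr//.
  by near: n; exact: s_ge.
have h := tail_ratio delta0 y0 bd.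
near=> n; have n0 : (0 < n)%N by near: n.
have [_] : ((1 - delta)%:E <
   lne (P [set w | (u * (s n * r n) <= Y n w)%R]) /
   (- q * (u * (s n * r n)) `^ (1 - eps))%:E /\
   lne (P [set w | (u * (s n * r n) <= Y n w)%R]) /
   (- q * (u * (s n * r n)) `^ (1 - eps))%:E < (1 + delta)%:E)%E.
  by near: n; exact: h.
move=> lt1; rewrite -powsr ?(ltW u0)// -mulrA -mulrN -mulNr.
apply: lne_ratio_gt => //; rewrite powsr ?(ltW u0)//.
rewrite mulNr oppr_lt0 mulr_gt0//.
by apply: mulr_gt0; [exact: powR_gt0|exact: s_gt0].
Unshelve. all: by end_near. Qed.

(** * Moments and moment generating functions along the array *)

Let moment_bounds (delta : R) : 0 < delta ->
  \forall n \near \oo, exists v w : R,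
    [/\ 'E_P[fun x => (Y n x ^+ 2)%R]%E = v%:E,
        'E_P[fun x => (`|Y n x| `^ (2 + gamma))%R]%E = w%:E,
        `|sigma ^+ 2 - v| <= delta, 0 <= w & w <= delta * r n `^ gamma].
Proof.
move=> delta0.
have /fine_cvgP[fin2 /cvgrPdist_le/(_ _ delta0) cv2] := second_moment.
have /fine_cvgP[fing /cvgrPdist_le/(_ _ delta0) cvg] := higher_moment.
pose E2 n := ('E_P[fun x => (Y n x ^+ 2)%R])%E.
pose Eg n := ('E_P[fun x => (`|Y n x| `^ (2 + gamma))%R])%E.
near=> n; have n0 : (0 < n)%N by near: n.
have rg0 : 0 < r n `^ gamma by rewrite powR_gt0// r_gt0.
have f2 : E2 n \is a fin_num by near: n.
have Eg0 : (0 <= Eg n)%E by apply: expectation_ge0 => x; exact: powR_ge0.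
have fg : (Eg n / (r n `^ gamma)%:E)%E \is a fin_num by rewrite -powr_gamma; near: n.
have wd : `|0 - fine (Eg n / (r n `^ gamma)%:E)%E| <= delta.
  by rewrite -powr_gamma; near: n; exact: cvg.
have vd : `|sigma ^+ 2 - fine (E2 n)| <= delta by near: n; exact: cv2.
exists (fine (E2 n)), (fine (Eg n)).
(* An infinite moment would make the ratio infinite, against [fg]. *)
move: Eg0 fg wd; rewrite -/(Eg n); case: (Eg n) => [w| |]//; last first.
  by rewrite inver gt_eqF// mulyr gtr0_sg ?invr_gt0// mul1e.
rewrite inver gt_eqF// -EFinM /= sub0r normrN lee_fin => w0 _.
rewrite ger0_norm ?divr_ge0 ?(ltW rg0)// ler_pdivrMr// => wd.
by split => //; rewrite -/(E2 n) fineK.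
Unshelve. all: by end_near. Qed.

Let scaled_powR n (t : R) : (0 < n)%N -> 0 <= t ->
  (t / r n) `^ (2 + gamma) = t `^ (2 + gamma) / (r n ^+ 2 * r n `^ gamma).
Proof.
move=> n0 t0; have r0 := r_gt0 n0.
rewrite powRM ?invr_ge0 ?(ltW r0)//; congr (_ * _).
rewrite -(powR_inv1 (ltW r0)) -powRrM mulN1r powRN; congr (_^-1).
rewrite powRD; last by rewrite (gt_eqF r0) implybT.
by rewrite (powR_mulrn _ (ltW r0)).
Qed.

(** At tilt [t / r] both the deviation of the second-order term and the term of order [2 + gamma]
    are [o(1 / r ^ 2)]: in the latter, [r ^ gamma] compensates the allowed growth of the moment. *)
Let moment_error (t C eta : R) : 0 <= t -> 0 <= C -> 0 < eta ->
  \forall n \near \oo, exists v w : R,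
    [/\ 'E_P[fun x => (Y n x ^+ 2)%R]%E = v%:E,
        'E_P[fun x => (`|Y n x| `^ (2 + gamma))%R]%E = w%:E &
        `|(t / r n) ^+ 2 * v / 2 - t ^+ 2 * sigma ^+ 2 / 2 / r n ^+ 2| +
          C * ((t / r n) `^ (2 + gamma) * w) <= eta / r n ^+ 2].
Proof.
move=> t0 C0 eta0; pose D := t ^+ 2 / 2 + C * t `^ (2 + gamma) + 1.
have Ct : 0 <= C * t `^ (2 + gamma) by rewrite mulr_ge0 ?powR_ge0.
have D0 : 0 < D by rewrite /D; have := sqr_ge0 t; lra.
have delta0 : 0 < eta / D by rewrite divr_gt0.
have h := moment_bounds delta0.
near=> n; have n0 : (0 < n)%N by near: n.
have [v [w [E2 Eg vd w0 wd]]] : exists v w : R,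
    [/\ 'E_P[fun x => (Y n x ^+ 2)%R]%E = v%:E,
        'E_P[fun x => (`|Y n x| `^ (2 + gamma))%R]%E = w%:E,
        `|sigma ^+ 2 - v| <= eta / D, 0 <= w & w <= eta / D * r n `^ gamma].
  by near: n; exact: h.
exists v, w; split => //.
have r0 := r_gt0 n0; have r20 : 0 < r n ^+ 2 by rewrite exprn_gt0.
have rg0 : 0 < r n `^ gamma by rewrite powR_gt0.
rewrite ler_pdivlMr// mulrDl.
have -> : `|(t / r n) ^+ 2 * v / 2 - t ^+ 2 * sigma ^+ 2 / 2 / r n ^+ 2| * r n ^+ 2 =
   t ^+ 2 / 2 * `|sigma ^+ 2 - v|.
  rewrite -[r n ^+ 2 in X in _ * X]ger0_norm ?sqr_ge0// -normrM -normrN.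
  rewrite -[t ^+ 2 / 2 in RHS]ger0_norm ?divr_ge0 ?sqr_ge0// -normrM.
  by congr `|_|; field; rewrite gt_eqF.
have -> : C * ((t / r n) `^ (2 + gamma) * w) * r n ^+ 2 =
   C * t `^ (2 + gamma) * (w / r n `^ gamma).
  by rewrite scaled_powR//; field; rewrite !gt_eqF.
have wd' : w / r n `^ gamma <= eta / D by rewrite ler_pdivrMr.
apply: (@le_trans _ _ (t ^+ 2 / 2 * (eta / D) + C * t `^ (2 + gamma) * (eta / D))).
  by apply: lerD; rewrite ler_wpM2l// divr_ge0 ?sqr_ge0.
rewrite -mulrDl mulrCA ler_piMr ?(ltW eta0)// ler_pdivrMr// mul1r /D; lra.
Unshelve. all: by end_near. Qed.

Let N_ge_s n : (0 < n)%N -> s n <= (N n)%:R.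
Proof.
move=> n0; rewrite NE// ler_peMr ?(ltW (s_gt0 n0))//.
by rewrite exprn_ege1// r_ge1.
Qed.

Let N_ge_r n : (0 < n)%N -> r n <= (N n)%:R.
Proof.
move=> n0; rewrite NE// expr2 mulrA ler_peMl ?(ltW (r_gt0 n0))//.
by rewrite mulr_ege1// ?s_ge1 ?r_ge1.
Qed.

(** The exponent [Q'] lies strictly between [Q] and [q]: the tail hypothesis gives [Q'], and the gap
    to [Q] makes the jump contribution negligible against [1 / r ^ 2]. *)
Let chernoff_mgf (t delta y eta : R) :
  0 <= t -> 0 < delta -> delta < 1 -> 0 < y -> 0 < eta ->
  \forall n \near \oo, exists2 e : R,
    ('E_P[chernoff_weight (1 - eps) (y * (s n * r n)) (r n)
      ((1 - delta) * q) (t / r n) \o Y n] = e%:E)%E &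
    e <= expR ((t ^+ 2 * sigma ^+ 2 / 2 + eta) / r n ^+ 2).
Proof.
move=> t0 delta0 delta1 y0 eta0.
have a0 : 0 < 1 - eps by rewrite subr_gt0.
set Q := (1 - delta) * q; pose Q' := (1 - delta / 2) * q.
have Q0 : 0 < Q by rewrite mulr_gt0// subr_gt0.
have QQ' : Q < Q' by rewrite ltr_pM2r//; lra.
have c0 : 0 < (Q' - Q) / 2 by lra.
have eta20 : 0 < eta / 2 by rewrite divr_gt0.
pose zeta := ln ((Q + Q') / (2 * Q)) / (1 - eps).
have zeta0 : 0 < zeta.
  by rewrite divr_gt0// ln_gt0// ltr_pdivlMr ?mul1r//; lra.
have ae0 : 0 < alpha * eps by rewrite mulr_gt0.
have hm := moment_error t0 (expR_ge0 t) eta20.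
have delta20 : 0 < delta / 2 by rewrite divr_gt0.
have ht := tail_le y0 delta20.
have he := powR_expR_small (2 / (alpha * eps) + 2) r_cvgy a0 c0 eta20.
near=> n; have n0 : (0 < n)%N by near: n.
have r0 := r_gt0 n0; have r20 : 0 < r n ^+ 2 by rewrite exprn_gt0.
have [v [w [E2 Eg vw]]] : exists v w : R,
    [/\ 'E_P[fun x => (Y n x ^+ 2)%R]%E = v%:E,
        'E_P[fun x => (`|Y n x| `^ (2 + gamma))%R]%E = w%:E &
        `|(t / r n) ^+ 2 * v / 2 - t ^+ 2 * sigma ^+ 2 / 2 / r n ^+ 2| +
          expR t * ((t / r n) `^ (2 + gamma) * w) <= eta / 2 / r n ^+ 2].
  by near: n; exact: hm.
have sy : y^-1 <= s n by near: n; exact: s_ge.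
have rz : y / zeta <= r n by near: n; exact: r_ge.
have rM : r n <= y * (s n * r n).
  by rewrite mulrA ler_peMl ?(ltW r0)// mulrC -ler_pdivrMr// mul1r.
(* A grid of [N ^ 2] cells reaches [y s r], since [y <= zeta r <= zeta N] and [s <= N]. *)
have NN0 : (0 < N n ^ 2)%N by rewrite expn_gt0 N_pos.
have Mz : y * (s n * r n) <= r n * expR (zeta * (N n ^ 2)%:R).
  rewrite mulrA mulrC ler_pM2l//.
  apply: (@le_trans _ _ (1 + zeta * (N n ^ 2)%:R)); last exact: expR_ge1Dx.
  rewrite natrX (@le_trans _ _ (zeta * (N n)%:R ^+ 2)) ?lerDr//.
  rewrite expr2 mulrA ler_pM ?(ltW y0) ?(ltW (s_gt0 n0)) ?N_ge_s//.
  rewrite mulrC -ler_pdivrMr// (le_trans rz)// N_ge_r//.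
have tl : forall u : R, r n <= u -> u <= y * (s n * r n) ->
    (P [set w | (u <= Y n w)%R] <= (expR (- (Q' * u `^ (1 - eps))))%:E)%E.
  by near: n; exact: ht.
have := expectation_chernoff_weight_le (Y_integrable n0) (Y_centered n0) E2 Eg
  gamma_gt0 gamma_le1 a0 r0 rM Q0 QQ' NN0 t0 Mz tl.
set E := ('E_P[_])%E => Ele.
have E0 : (0 <= E)%E by apply: expectation_ge0 => x; exact: chernoff_weight_ge0.
have Efin : E \is a fin_num by rewrite ge0_fin_numE// (le_lt_trans Ele)// ltry.
exists (fine E); first by rewrite fineK.
move: Ele; rewrite -(fineK Efin) lee_fin => /le_trans; apply.
apply: le_trans (expR_ge1Dx _).
(* As [N = r ^ (1 / (alpha eps))], the number of cells is polynomial in [r], and the stretched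
   exponential beats it. *)
have last_le : (N n ^ 2)%:R * expR (- ((Q' - Q) / 2 * r n `^ (1 - eps))) <= eta / 2 / r n ^+ 2.
  rewrite ler_pdivlMr// mulrAC.
  have -> : (N n ^ 2)%:R * r n ^+ 2 = r n `^ (2 / (alpha * eps) + 2).
    rewrite powRD; last by rewrite (gt_eqF r0) implybT.
    rewrite powR_mulrn ?(ltW r0)// mulrC [RHS]mulrC; congr (_ * _).
    rewrite /r -powRrM mulrC divfK ?gt_eqF// natrX powR_mulrn//.
  by near: n; exact: he.
move: (ler_norm ((t / r n) ^+ 2 * v / 2 - t ^+ 2 * sigma ^+ 2 / 2 / r n ^+ 2)) vw last_le.
rewrite mulrDl; lra.
Unshelve. all: by end_near. Qed.

(** The upper bound comes from [chernoff_weight], which dominates [truncated_exp] pointwise; the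
    values [y = 1] and [delta = 1 / 2] are convenient choices. *)
Let truncated_mgf (t eta : R) : 0 < t -> 0 < eta ->
  \forall n \near \oo, exists e : R,
    [/\ ('E_P[truncated_exp (r n) (t / r n) \o Y n] = e%:E)%E,
        expR ((t ^+ 2 * sigma ^+ 2 / 2 - eta) / r n ^+ 2) <= e &
        e <= expR ((t ^+ 2 * sigma ^+ 2 / 2 + eta) / r n ^+ 2)].
Proof.
move=> t0 eta0; have eta20 : 0 < eta / 2 by rewrite divr_gt0.
have half0 : 0 < 2^-1 :> R by rewrite invr_gt0.
have half1 : 2^-1 < 1 :> R by lra.
have hc := chernoff_mgf (ltW t0) half0 half1 ltr01 eta0.
pose C := expR t + 3 + 3 / t `^ (2 + gamma).
have C0 : 0 <= C by rewrite !addr_ge0 ?expR_ge0 ?divr_ge0 ?powR_ge0.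
have hm := moment_error (ltW t0) C0 eta20.
(* Half of [eta] pays for the moment errors, the other half for passing from [1 + A / r ^ 2] to an
   exponential. *)
pose A := t ^+ 2 * sigma ^+ 2 / 2 - eta / 2.
near=> n; have n0 : (0 < n)%N by near: n.
have r0 := r_gt0 n0; have r20 : 0 < r n ^+ 2 by rewrite exprn_gt0.
have rA : 2 * A ^+ 2 / eta + `|A| + 1 <= r n by near: n; exact: r_ge.
have [v [w [E2 Eg vw]]] : exists v w : R,
    [/\ 'E_P[fun x => (Y n x ^+ 2)%R]%E = v%:E,
        'E_P[fun x => (`|Y n x| `^ (2 + gamma))%R]%E = w%:E &
        `|(t / r n) ^+ 2 * v / 2 - t ^+ 2 * sigma ^+ 2 / 2 / r n ^+ 2| +
          C * ((t / r n) `^ (2 + gamma) * w) <= eta / 2 / r n ^+ 2].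
  by near: n; exact: hm.
have [e eE ele] : exists2 e : R,
    ('E_P[chernoff_weight (1 - eps) (1 * (s n * r n)) (r n)
      ((1 - 2^-1) * q) (t / r n) \o Y n] = e%:E)%E &
    e <= expR ((t ^+ 2 * sigma ^+ 2 / 2 + eta) / r n ^+ 2).
  by near: n; exact: hc.
set E := ('E_P[truncated_exp (r n) (t / r n) \o Y n])%E.
have Ee : (E <= e%:E)%E.
  rewrite -eE; apply: expectation_le => //.
  - by apply: measurableT_comp => //; exact: measurable_truncated_exp.
  - by apply: measurableT_comp => //; exact: measurable_chernoff_weight.
  - by move=> x; exact: truncated_exp_ge0.
  - by move=> x; exact: chernoff_weight_ge0.
  apply: aeW => x; rewrite /= /truncated_exp /chernoff_weight.
  by case: ifP => // _; exact: expR_ge0.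
have E0 : (0 <= E)%E by apply: expectation_ge0 => x; exact: truncated_exp_ge0.
have Efin : E \is a fin_num by rewrite ge0_fin_numE// (le_lt_trans Ee)// ltry.
exists (fine E); split; first by rewrite fineK.
  rewrite -lee_fin fineK//.
  apply: le_trans (expectation_truncated_exp_ge (Y_integrable n0) (Y_centered n0) E2 Eg
    gamma_gt0 gamma_le1 r0 t0).
  rewrite lee_fin -/C (_ : _ - eta = A - eta / 2); last by rewrite /A; lra.
  apply: (le_trans (expR_le1D_shift eta0 _)).
    rewrite (le_trans rA)// expr2 ler_peMl ?r_ge1// ltW//.
  move: (ler_norm (- ((t / r n) ^+ 2 * v / 2 - t ^+ 2 * sigma ^+ 2 / 2 / r n ^+ 2))) vw.
  rewrite normrN /A mulrBl; lra.
by rewrite (le_trans _ ele)// -lee_fin fineK.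
Unshelve. all: by end_near. Qed.

Let row_mgf n (i : 'I_(N n)) (g : R -> R) : (0 < n)%N ->
  measurable_fun setT g -> (forall x, 0 <= g x) ->
  ('E_P[g \o Yrow n i] = 'E_P[g \o Y n])%E.
Proof. by move=> n0; apply: expectation_same_law; exact: Yrow_law. Qed.

(** * Rate function and upper bound *)

Let rate (y theta : R) : R :=
  q * theta `^ (1 - eps) * y `^ (1 - eps) +
  (1 - theta) ^+ 2 * y ^+ 2 / (2 * sigma ^+ 2).

(** One [eta] pays for replacing [q] by [(1 - delta) * q], the other for shortening [1 - theta] by
    one bin width. In the last bin [c] is 0, where the shortened value would be negative. *)
Let bin_rate (y delta eta : R) (K k : nat) (c : R) :
  0 < y -> 0 <= delta -> delta * (q * y `^ (1 - eps)) <= eta ->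
  (0 < K)%N -> y ^+ 2 / (sigma ^+ 2 * K%:R) <= eta -> (k <= K)%N ->
  c = (if (k < K)%N then 1 - k.+1%:R / K%:R else 0) ->
  rate y (k%:R / K%:R) - eta - eta <=
  c ^+ 2 * y ^+ 2 / (2 * sigma ^+ 2) +
  (1 - delta) * q * (k%:R / K%:R * y) `^ (1 - eps).
Proof.
move=> y0 delta0 deltale K0 Kle kK cE.
have K0' : 0 < K%:R :> R by rewrite ltr0n.
have th0 : 0 <= k%:R / K%:R :> R by rewrite divr_ge0.
have th1 : k%:R / K%:R <= 1 :> R by rewrite ler_pdivrMr// mul1r ler_nat.
rewrite powRM ?(ltW y0)// /rate.
set th := k%:R / K%:R in th0 th1 *.
have thp1 : th `^ (1 - eps) <= 1.
  rewrite [leRHS](_ : _ = 1 `^ (1 - eps)); last by rewrite powR1.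
  apply: ge0_ler_powR; rewrite ?nnegrE//.
  by rewrite subr_ge0 ltW.
have thp0 : 0 <= th `^ (1 - eps) by exact: powR_ge0.
have yp0 : 0 <= y `^ (1 - eps) by exact: powR_ge0.
have jump : q * th `^ (1 - eps) * y `^ (1 - eps) - eta <=
    (1 - delta) * q * (th `^ (1 - eps) * y `^ (1 - eps)).
  have : delta * (q * y `^ (1 - eps)) * th `^ (1 - eps) <= eta.
    apply: le_trans deltale; rewrite ler_piMr// !mulr_ge0// ltW//.
  lra.
have cb : (1 - th) ^+ 2 - c ^+ 2 <= 2 / K%:R.
  have iK : 0 < K%:R^-1 :> R by rewrite invr_gt0.
  rewrite cE; case: ifPn => [_|].
    rewrite -natr1 mulrDl mul1r -/th; nra.
  rewrite -leqNgt => Kk; have -> : th = 1.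
    by rewrite /th (_ : k = K) ?divff ?gt_eqF//; apply/eqP; rewrite eqn_leq kK.
  by rewrite subrr expr0n/= subrr mulr_ge0// ltW.
have sg : 0 < sigma ^+ 2 by rewrite exprn_gt0.
have bulk : (1 - th) ^+ 2 * y ^+ 2 / (2 * sigma ^+ 2) - eta <=
    c ^+ 2 * y ^+ 2 / (2 * sigma ^+ 2).
  rewrite lerBlDr -lerBlDl -mulrBl -mulrBl (le_trans _ Kle)//.
  have -> : y ^+ 2 / (sigma ^+ 2 * K%:R) = 2 / K%:R * y ^+ 2 / (2 * sigma ^+ 2).
    by field; rewrite !gt_eqF.
  apply: ler_wpM2r; first by rewrite invr_ge0 mulr_ge0// ltW.
  by apply: ler_wpM2r => //; exact: sqr_ge0.
by lra.
Qed.

Let sum_tail_upper (y eta I : R) : 0 < y -> 0 < eta ->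
  (forall theta, 0 <= theta -> theta <= 1 -> I <= rate y theta) ->
  \forall n \near \oo,
    (P [set w | (y * (s n * r n) <= \sum_i Yrow n i w)%R] <=
     (expR (- (s n * (I - eta))))%:E)%E.
Proof.
move=> y0 eta0 Ile.
(* Two quarters go to [bin_rate], one to the moment generating function, one to the number of
   bins. *)
pose eta' := eta / 4; have eta'0 : 0 < eta' by rewrite divr_gt0.
have sg : 0 < sigma ^+ 2 by rewrite exprn_gt0.
have yp : 0 < y `^ (1 - eps) by exact: powR_gt0.
pose B := q * y `^ (1 - eps); have B0 : 0 < B by rewrite mulr_gt0.
pose delta := Num.min 2^-1 (eta' / B).
have delta0 : 0 < delta by rewrite lt_min invr_gt0 divr_gt0// ltr0n.
have delta1 : delta < 1 by rewrite gt_min; apply/orP; left; lra.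
have deltale : delta * B <= eta' by rewrite -ler_pdivlMr// ge_min lexx orbT.
have a0 : 0 < 1 - eps by rewrite subr_gt0.
have a1 : 1 - eps <= 1 by rewrite lerBlDr lerDl ltW.
pose K := (Num.truncn (y ^+ 2 / (sigma ^+ 2 * eta'))).+1.
have K0 : (0 < K)%N by [].
have K0' : 0 < K%:R :> R by rewrite ltr0n.
have Kle : y ^+ 2 / (sigma ^+ 2 * K%:R) <= eta'.
  have : y ^+ 2 / (sigma ^+ 2 * eta') <= K%:R.
    have : 0 <= y ^+ 2 / (sigma ^+ 2 * eta').
      by apply: divr_ge0; [exact: sqr_ge0|rewrite mulr_ge0// ltW].
    by move/Num.Theory.truncn_itv => /andP[_ /ltW].
  by rewrite !ler_pdivrMr ?mulr_gt0// => h; rewrite (le_trans h)// le_eqVlt;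
    apply/orP; left; apply/eqP; ring.
pose c k : R := if (k < K)%N then 1 - k.+1%:R / K%:R else 0.
have c0 k : 0 <= c k.
  by rewrite /c; case: ifP => // kK; rewrite subr_ge0 ler_pdivrMr// mul1r ler_nat.
(* The optimal Gaussian tilt for a bulk sum of size [c k * y], at cost [t ^ 2 sigma ^ 2 / 2]. *)
pose t k := c k * y / sigma ^+ 2.
have t0 k : 0 <= t k by rewrite divr_ge0 ?mulr_ge0// ltW.
have hm := filter_forall _ (fun k : 'I_K.+1 => chernoff_mgf (t0 k) delta0 delta1 y0 eta'0).
near=> n; have n0 : (0 < n)%N by near: n.
have r0 := r_gt0 n0; have s0 := s_gt0 n0.
have /choice[e He] : forall k : 'I_K.+1, exists e : R,
    ('E_P[chernoff_weight (1 - eps) (y * (s n * r n)) (r n)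
      ((1 - delta) * q) (t k / r n) \o Y n] = e%:E)%E /\
    e <= expR ((t k ^+ 2 * sigma ^+ 2 / 2 + eta') / r n ^+ 2).
  suff h : forall k : 'I_K.+1, exists2 e : R,
    ('E_P[chernoff_weight (1 - eps) (y * (s n * r n)) (r n)
      ((1 - delta) * q) (t k / r n) \o Y n] = e%:E)%E &
    e <= expR ((t k ^+ 2 * sigma ^+ 2 / 2 + eta') / r n ^+ 2).
    by move=> k; have [e ? ?] := h k; exists e.
  by near: n; exact: hm.
have sK : (K.+1)%:R <= expR (s n * eta').
  apply: le_trans (expR_ge1Dx _).
  by rewrite -lerBlDl -ler_pdivrMr//; near: n; exact: s_ge.
have M0 : 0 < y * (s n * r n) by rewrite !mulr_gt0.
have Q0 : 0 <= (1 - delta) * q by rewrite mulr_ge0 ?ltW// subr_gt0.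
pose e' k := e (inord k).
have eE k i : (k <= K)%N -> ('E_P[chernoff_weight (1 - eps) (y * (s n * r n)) (r n)
      ((1 - delta) * q) (t k / r n) \o Yrow n i] = (e' k)%:E)%E.
  move=> kK; rewrite row_mgf//; last 2 first.
  - exact: measurable_chernoff_weight.
  - by move=> x; exact: chernoff_weight_ge0.
  by have [<- _] := He (inord k); rewrite inordK.
have lam0 k : 0 <= t k / r n by rewrite divr_ge0// ltW.
have lamK : t K / r n = 0 by rewrite /t /c ltnn !mul0r.
apply: (le_trans (sum_tail_le (Yrow_indep n0) a0 a1 M0 (ltW r0) Q0 K0 lam0 lamK eE)).
rewrite lee_fin.
apply: (@le_trans _ _ (\sum_(k < K.+1) expR (- (s n * (I - eta' - eta' - eta'))))).
  apply: ler_sum => k _; have kK : (k <= K)%N by rewrite -ltnS.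
  have [Ee ele] := He k.
  have e0 : 0 <= e k.
    by rewrite -lee_fin -Ee; apply: expectation_ge0 => x; exact: chernoff_weight_ge0.
  rewrite /e' inord_val card_ord.
  apply: (@le_trans _ _ (expR (- (t k / r n * ((1 - k.+1%:R / K%:R) * (y * (s n * r n))) +
     (1 - delta) * q * (k%:R / K%:R * (y * (s n * r n))) `^ (1 - eps))) *
     expR ((t k ^+ 2 * sigma ^+ 2 / 2 + eta') / r n ^+ 2) ^+ N n)).
    by rewrite ler_wpM2l ?expR_ge0// lerXn2r// nnegrE expR_ge0.
  (* Since [N = s r ^ 2], the product of [N] means brings the exponent to the scale [s]. *)
  rewrite -expRM_natl -expRD ler_expR NE//.
  have -> : s n * r n ^+ 2 * ((t k ^+ 2 * sigma ^+ 2 / 2 + eta') / r n ^+ 2) =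
      s n * (t k ^+ 2 * sigma ^+ 2 / 2 + eta').
    by field; rewrite gt_eqF.
  rewrite (mulrA (k%:R / K%:R) y) powsr//; last by rewrite mulr_ge0 ?divr_ge0// ltW.
  have -> : t k / r n * ((1 - k.+1%:R / K%:R) * (y * (s n * r n))) = s n * (t k ^+ 2 * sigma ^+ 2).
    rewrite /t /c; case: ifP => _; first by field; rewrite !gt_eqF.
    by rewrite !mul0r expr0n/= !mul0r mulr0.
  have := bin_rate y0 (ltW delta0) deltale K0 Kle kK (erefl (c k)).
  have := Ile (k%:R / K%:R).
  have -> : c k ^+ 2 * y ^+ 2 / (2 * sigma ^+ 2) = t k ^+ 2 * sigma ^+ 2 / 2.
    by rewrite /t; field; rewrite gt_eqF.
  set p := (_ `^ _); set th := _ / _ => h1 h2.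
  have {h1 h2} h : I - eta' - eta' <= t k ^+ 2 * sigma ^+ 2 / 2 + (1 - delta) * q * p.
    apply: le_trans h2; rewrite lerD2r lerD2r h1 ?divr_ge0//.
    by rewrite ler_pdivrMr// mul1r ler_nat.
  by have := ler_wpM2l (ltW s0) h; lra.
rewrite sumr_const card_ord -mulr_natl.
apply: (@le_trans _ _ (expR (s n * eta') * expR (- (s n * (I - eta' - eta' - eta'))))).
  by rewrite ler_wpM2r ?expR_ge0.
by rewrite -expRD ler_expR /eta'; lra.
Unshelve. all: by end_near. Qed.

(** * Lower bound *)

(* One summand makes a jump of size [u] while the others carry the remaining
   [a] at Gaussian cost. *)
Let sum_tail_lower (u a eta : R) : 0 < u -> 0 < a -> 0 < eta ->
  \forall n \near \oo,
    ((expR (- (s n * (q * u `^ (1 - eps) + a ^+ 2 / (2 * sigma ^+ 2) + eta))))%:E <=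
     P [set w | ((u + a) * (s n * r n) <= \sum_i Yrow n i w)%R])%E.
Proof.
move=> u0 a0 eta0.
have sg : 0 < sigma ^+ 2 by rewrite exprn_gt0.
have up : 0 < u `^ (1 - eps) by exact: powR_gt0.
pose B := q * u `^ (1 - eps); have B0 : 0 < B by rewrite mulr_gt0.
pose delta := eta / 4 / B.
have delta0 : 0 < delta by rewrite !divr_gt0.
have deltaB : delta * B = eta / 4 by rewrite divfK ?gt_eqF.
pose kap := Num.min 1 (eta * sigma ^+ 2 / (4 * (2 * a + 2))).
have a20 : 0 < 4 * (2 * a + 2) by lra.
have kap0 : 0 < kap by rewrite lt_min ltr01/= divr_gt0// mulr_gt0.
have kap1 : kap <= 1 by rewrite ge_min lexx.
have kaple : kap * (2 * a + 2) / sigma ^+ 2 <= eta / 4.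
  have : kap <= eta * sigma ^+ 2 / (4 * (2 * a + 2)) by rewrite ge_min lexx orbT.
  by rewrite ler_pdivlMr// ler_pdivrMr//; lra.
pose h := kap / sigma ^+ 2; have h0 : 0 < h by rewrite divr_gt0.
(* The tilt [t] centres the bulk at [a + kap], the middle of the window from [a] to [a + 2 kap]; the
   shift [h] moves the centre by [kap], to an end of the window. *)
pose t := (a + kap) / sigma ^+ 2.
have tm0 : 0 < t - h by rewrite -mulrBl addrK divr_gt0.
have t0 : 0 < t by lra.
have tp0 : 0 < t + h by lra.
(* Shifting by [h] loses [kap ^ 2 / (2 sigma ^ 2) = 4 e1]. After the errors [e1] of both means, a
   gap of [2 e1] remains between the window and its outside. *)
pose e1 := kap ^+ 2 / (8 * sigma ^+ 2).
have e10 : 0 < e1 by rewrite divr_gt0 ?exprn_gt0 ?mulr_gt0.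
have e120 : 0 < 2 * e1 by lra.
pose A := t ^+ 2 * sigma ^+ 2 / 2 - e1.
have hm := truncated_mgf t0 e10.
have hp := truncated_mgf tp0 e10.
have hn := truncated_mgf tm0 e10.
have ht := tail_ge u0 delta0.
have shiftp : (t + h) ^+ 2 * sigma ^+ 2 / 2 + e1 - h * (a + 2 * kap) = A - 2 * e1.
  by rewrite /A /e1 /t /h; field; rewrite gt_eqF.
have shiftm : (t - h) ^+ 2 * sigma ^+ 2 / 2 + e1 + h * a = A - 2 * e1.
  by rewrite /A /e1 /t /h; field; rewrite gt_eqF.
have cost : t * (a + 2 * kap) - A <= a ^+ 2 / (2 * sigma ^+ 2) + eta / 4.
  apply: le_trans (lerD (lexx _) kaple).
  have -> : t * (a + 2 * kap) - A =
      ((a + kap) ^+ 2 / 2 + kap * (a + kap) + kap ^+ 2 / 8) / sigma ^+ 2.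
    by rewrite /A /e1 /t; field; rewrite gt_eqF.
  have -> : a ^+ 2 / (2 * sigma ^+ 2) + kap * (2 * a + 2) / sigma ^+ 2 =
     (a ^+ 2 / 2 + kap * (2 * a + 2)) / sigma ^+ 2 by field; rewrite gt_eqF.
  by rewrite ler_pM2r ?invr_gt0//; nra.
near=> n; have n0 : (0 < n)%N by near: n.
have r0 := r_gt0 n0; have s0 := s_gt0 n0.
have r20 : 0 < r n ^+ 2 by rewrite exprn_gt0.
have [e [Ee ege _]] : exists e : R,
    [/\ ('E_P[truncated_exp (r n) (t / r n) \o Y n] = e%:E)%E,
        expR ((t ^+ 2 * sigma ^+ 2 / 2 - e1) / r n ^+ 2) <= e &
        e <= expR ((t ^+ 2 * sigma ^+ 2 / 2 + e1) / r n ^+ 2)].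
  by near: n; exact: hm.
have [ep [Eep _ eple]] : exists e : R,
    [/\ ('E_P[truncated_exp (r n) ((t + h) / r n) \o Y n] = e%:E)%E,
        expR (((t + h) ^+ 2 * sigma ^+ 2 / 2 - e1) / r n ^+ 2) <= e &
        e <= expR (((t + h) ^+ 2 * sigma ^+ 2 / 2 + e1) / r n ^+ 2)].
  by near: n; exact: hp.
have [em [Eem _ emle]] : exists e : R,
    [/\ ('E_P[truncated_exp (r n) ((t - h) / r n) \o Y n] = e%:E)%E,
        expR (((t - h) ^+ 2 * sigma ^+ 2 / 2 - e1) / r n ^+ 2) <= e &
        e <= expR (((t - h) ^+ 2 * sigma ^+ 2 / 2 + e1) / r n ^+ 2)].
  by near: n; exact: hn.
have pge : ((expR (- ((1 + delta) * q * (u `^ (1 - eps) * s n))))%:E <=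
     P [set w | (u * (s n * r n) <= Y n w)%R])%E.
  by near: n; exact: ht.
(* The first threshold makes each outside contribution at most a quarter of the main term; the
   second absorbs [ln 2 + |A|] into half of [eta]. *)
have s1 : (ln 4 + `|A|) / (2 * e1) <= s n by near: n; exact: s_ge.
have s2 : (ln 2 + `|A|) / (eta / 2) <= s n by near: n; exact: s_ge.
pose i0 : 'I_(N n) := Ordinal (N_pos n0).
set m := u * (s n * r n) in pge *.
pose pm := fine (P [set w | (m <= Y n w)%R]).
have Ppm : (P [set w | (m <= Yrow n i0 w)%R] = pm%:E)%E.
  rewrite /pm fineK ?prob_fin//.
  have mB : measurable [set x : R | m <= x] by rewrite -set_itvcy.
  exact: (Yrow_law n0 i0 mB).
have rowE l e' : ('E_P[truncated_exp (r n) l \o Y n] = e'%:E)%E ->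
    forall i, ('E_P[truncated_exp (r n) l \o Yrow n i] = e'%:E)%E.
  move=> <- i; apply: row_mgf => //; first exact: measurable_truncated_exp.
  by move=> x; exact: truncated_exp_ge0.
have l0 : 0 <= t / r n by rewrite divr_ge0// ltW.
have hr0 : 0 <= h / r n by rewrite divr_ge0// ltW.
rewrite mulrDl in Eep; rewrite mulrBl in Eem.
have := @sum_tail_ge _ _ _ P _ i0 (Yrow n) (r n) m (a * (s n * r n))
  ((a + 2 * kap) * (s n * r n)) (t / r n) (h / r n) pm e ep em (Yrow_indep n0) l0 hr0 Ppm
  (rowE _ _ Ee) (rowE _ _ Eep) (rowE _ _ Eem).
have mS : measurable_fun setT (fun w => \sum_i Yrow n i w) by exact: measurable_sum.
have Pfin : P [set w | m + a * (s n * r n) <= \sum_i Yrow n i w] \is a fin_num.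
  by apply: fin_num_measure; exact: measurable_superlevel.
rewrite [(u + a) * _]mulrDl -/m -(fineK Pfin) -EFinM !lee_fin card_ord.
set p := fine _ => key.
have e0 : 0 <= e by rewrite (le_trans _ ege) ?expR_ge0.
have trunc0 l e' : ('E_P[truncated_exp (r n) l \o Y n] = e'%:E)%E -> 0 <= e'.
  by rewrite -lee_fin => <-; apply: expectation_ge0 => x; exact: truncated_exp_ge0.
have ep0 := trunc0 _ _ Eep; have em0 := trunc0 _ _ Eem.
(* Only [N - 1] terms form the bulk; the missing one changes the exponent by [A / r ^ 2], at most
   [|A|] in absolute value. *)
have NP : (N n).-1%:R / r n ^+ 2 = s n - (r n ^+ 2)^-1.
  rewrite -subn1 natrB ?N_pos// NE// mulrBl mul1r mulfK// gt_eqF//.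
have ir2 : (r n ^+ 2)^-1 <= 1 by rewrite invf_le1// exprn_ege1// r_ge1.
have ir20 : 0 <= (r n ^+ 2)^-1 by rewrite invr_ge0 ltW.
have Ege : expR (s n * A - `|A|) <= e ^+ (N n).-1.
  apply: (@le_trans _ _ (expR (A / r n ^+ 2) ^+ (N n).-1)); last first.
    by rewrite lerXn2r// nnegrE expR_ge0.
  rewrite -expRM_natl ler_expR mulrCA NP.
  by have := ler_norm A; have := normr_ge0 A; nra.
have Ele l e' : 0 <= e' -> e' <= expR ((l ^+ 2 * sigma ^+ 2 / 2 + e1) / r n ^+ 2) ->
    e' ^+ (N n).-1 <= expR (s n * (l ^+ 2 * sigma ^+ 2 / 2 + e1)).
  move=> e'0 e'le.
  apply: (@le_trans _ _ (expR ((l ^+ 2 * sigma ^+ 2 / 2 + e1) / r n ^+ 2) ^+ (N n).-1)).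
    by rewrite lerXn2r// nnegrE expR_ge0.
  rewrite -expRM_natl ler_expR mulrCA NP mulrC.
  apply: ler_wpM2r; last by rewrite gerBl.
  by apply: addr_ge0; [apply: divr_ge0; [rewrite mulr_ge0 ?sqr_ge0|]|exact: ltW].
have Eple := Ele _ _ ep0 eple; have Emle := Ele _ _ em0 emle.
have hb : h / r n * ((a + 2 * kap) * (s n * r n)) = s n * (h * (a + 2 * kap)).
  by field; rewrite gt_eqF.
have ha : h / r n * (a * (s n * r n)) = s n * (h * a) by field; rewrite gt_eqF.
have tb : t / r n * ((a + 2 * kap) * (s n * r n)) = s n * (t * (a + 2 * kap)).
  by field; rewrite gt_eqF.
rewrite hb ha tb in key.
have off : 4 * expR (s n * (A - 2 * e1)) <= expR (s n * A - `|A|).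
  rewrite -[X in X * _](@lnK _ 4) ?posrE// -expRD ler_expR.
  by move: s1; rewrite ler_pdivrMr//; lra.
have offp : expR (- (s n * (h * (a + 2 * kap)))) * ep ^+ (N n).-1 <= expR (s n * (A - 2 * e1)).
  rewrite -shiftp mulrBr expRD mulrC ler_wpM2r ?expR_ge0//.
have offm : expR (s n * (h * a)) * em ^+ (N n).-1 <= expR (s n * (A - 2 * e1)).
  by rewrite -shiftm mulrDr expRD mulrC ler_wpM2r ?expR_ge0.
have half : expR (s n * A - `|A|) / 2 <= e ^+ (N n).-1 -
    expR (- (s n * (h * (a + 2 * kap)))) * ep ^+ (N n).-1 -
    expR (s n * (h * a)) * em ^+ (N n).-1 by lra.
have pmge : expR (- ((1 + delta) * q * (u `^ (1 - eps) * s n))) <= pm.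
  by rewrite -lee_fin /pm fineK// prob_fin.
have : expR (- ((1 + delta) * q * (u `^ (1 - eps) * s n))) * (expR (s n * A - `|A|) / 2) <=
    expR (s n * (t * (a + 2 * kap))) * p.
  apply: le_trans key; apply: ler_pM; rewrite ?expR_ge0 ?divr_ge0 ?expR_ge0//.
rewrite -ler_pdivrMl ?expR_gt0// -expRN; apply: le_trans.
rewrite [leRHS](_ : _ = expR (- (s n * (t * (a + 2 * kap))) -
    (1 + delta) * q * (u `^ (1 - eps) * s n) + (s n * A - `|A|) - ln 2)); last first.
  rewrite (expRD _ (- ln 2)) (expRN (ln 2)) lnK ?posrE//.
  by rewrite (expRD _ (s n * A - `|A|)) (expRD (- (s n * (t * (a + 2 * kap))))) !mulrA.
rewrite ler_expR.
(* The budget: [eta / 4] for the window, [eta / 4] for the jump probability, [eta / 2] for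
   [ln 2 + |A|]. *)
have : s n * (t * (a + 2 * kap) - A) <= s n * (a ^+ 2 / (2 * sigma ^+ 2) + eta / 4).
  by rewrite ler_wpM2l// ltW.
have -> : (1 + delta) * q * (u `^ (1 - eps) * s n) = s n * (B + delta * B) by rewrite /B; ring.
rewrite deltaB.
move: s2; rewrite ler_pdivrMr ?divr_gt0// -/B; lra.
Unshelve. all: by end_near. Qed.

(** * Infimum of the rate *)

Let rate_inf (y : R) : R := inf [set rate y theta | theta in [set t : R | 0 <= t <= 1]].

Let rate_ge0 (y theta : R) : 0 <= rate y theta.
Proof.
apply: addr_ge0; first by rewrite !mulr_ge0 ?powR_ge0// ltW.
by apply: divr_ge0; apply: mulr_ge0 => //; exact: sqr_ge0.
Qed.

Let rate_inf_le (y theta : R) : 0 <= theta -> theta <= 1 -> rate_inf y <= rate y theta.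
Proof.
move=> t0 t1; apply: ge_inf; last by exists theta => //=; rewrite t0.
by exists 0 => _ [t _ <-]; exact: rate_ge0.
Qed.

Let rate_inf_adherent (y eta : R) : 0 < eta ->
  exists theta, [/\ 0 <= theta, theta <= 1 & rate y theta < rate_inf y + eta].
Proof.
move=> eta0; have : has_inf [set rate y theta | theta in [set t : R | 0 <= t <= 1]].
  split; first by exists (rate y 0), 0 => //=; rewrite lexx ler01.
  by exists 0 => _ [t _ <-]; exact: rate_ge0.
by move=> /(inf_adherent eta0)[_ [t /andP[t0 t1] <-] lt_t]; exists t.
Qed.

(* Perturbing [theta y] and [(1 - theta) y] by [kap > 0] covers the degenerate
   cases [y = 0], [theta = 0] and [theta = 1]. *)
Let rate_perturb (y theta eta : R) : 0 <= y -> 0 <= theta -> theta <= 1 ->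
  0 < eta -> exists u a : R, [/\ 0 < u, 0 < a, y <= u + a &
    q * u `^ (1 - eps) + a ^+ 2 / (2 * sigma ^+ 2) <= rate y theta + eta].
Proof.
move=> y0 t0 t1 eta0.
have a0 : 0 < 1 - eps by rewrite subr_gt0.
have a1 : 1 - eps <= 1 by rewrite lerBlDr lerDl ltW.
have sg : 0 < sigma ^+ 2 by rewrite exprn_gt0.
have q2 : 0 < eta / (2 * q) by rewrite divr_gt0// mulr_gt0.
(* The value [k1] solves [q k1 ^ (1 - eps) = eta / 2]. The value [k2] bounds the growth of the
   square, at most [kap (2 y + 1)] for [kap <= 1], by [eta sigma ^ 2]. *)
pose k1 := (eta / (2 * q)) `^ (1 - eps)^-1.
pose k2 := eta * sigma ^+ 2 / (2 * y + 1).
pose kap := Num.min 1 (Num.min k1 k2).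
have y1 : 0 < 2 * y + 1 by lra.
have k10 : 0 < k1 by exact: powR_gt0.
have k20 : 0 < k2 by rewrite divr_gt0// mulr_gt0.
have kap0 : 0 < kap by rewrite !lt_min ltr01 k10.
have kap1 : kap <= 1 by rewrite ge_min lexx.
have kapk1 : kap <= k1 by rewrite !ge_min lexx /= orbT.
have kapk2 : kap <= k2 by rewrite !ge_min lexx !orbT.
have ty0 : 0 <= theta * y by rewrite mulr_ge0.
have ty1 : 0 <= (1 - theta) * y by rewrite mulr_ge0// subr_ge0.
exists (theta * y + kap), ((1 - theta) * y + kap); split; try lra.
have jump : q * (theta * y + kap) `^ (1 - eps) <=
    q * theta `^ (1 - eps) * y `^ (1 - eps) + eta / 2.
  have qk : q * kap `^ (1 - eps) <= eta / 2.
    apply: (@le_trans _ _ (q * k1 `^ (1 - eps))).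
      rewrite ler_pM2l//; apply: ge0_ler_powR; rewrite ?nnegrE//; exact: ltW.
    rewrite /k1 -powRrM mulVf ?gt_eqF// powRr1 ?(ltW q2)//.
    by rewrite le_eqVlt; apply/orP; left; apply/eqP; field; rewrite gt_eqF.
  apply: le_trans (lerD (lexx _) qk).
  rewrite -mulrA -powRM// -mulrDr ler_pM2l//.
  by apply: powR_subadd => //; exact: ltW.
have bulk : ((1 - theta) * y + kap) ^+ 2 / (2 * sigma ^+ 2) <=
    (1 - theta) ^+ 2 * y ^+ 2 / (2 * sigma ^+ 2) + eta / 2.
  have k2le : kap * (2 * y + 1) <= eta * sigma ^+ 2 by rewrite -ler_pdivlMr.
  have D0 : 0 < 2 * sigma ^+ 2 by lra.
  rewrite ler_pdivrMr// [leRHS]mulrDl divfK ?gt_eqF//.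
  have ty : (1 - theta) * y <= y by rewrite ler_piMl//; lra.
  have : kap * ((1 - theta) * y) <= kap * y by rewrite ler_pM2l.
  have : kap ^+ 2 <= kap by rewrite expr2 ler_piMl// ltW.
  move: k2le; rewrite -exprMn; move: ((1 - theta) * y) => z; lra.
by rewrite /rate; move: jump bulk; lra.
Qed.

(** * Convergence of the scaled logarithms *)

Lemma scaled_log_cvg (y : R) : 0 <= y ->
  (((1 / (N n)%:R `^ ((1 - eps) / (1 + eps)))%R)%:E *
    lne (P [set w | ((N n)%:R `^ (1 / (1 + eps)) * y
                    <= \sum_(i < N n) Yrow n i w)%R]))%E
    @[n --> \oo] -->
  (- inf [set q * theta `^ (1 - eps) * y `^ (1 - eps)
              + (1 - theta) ^+ 2 * y ^+ 2 / (2 * sigma ^+ 2)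
         | theta in [set t : R | 0 <= t <= 1]])%:E.
Proof.
move=> y0; rewrite -[inf _]/(rate_inf y); set I := rate_inf y.
pose p n := P [set w | y * (s n * r n) <= \sum_(i < N n) Yrow n i w].
have mS n : measurable_fun setT (fun w => \sum_(i < N n) Yrow n i w).
  exact: measurable_sum.
have pfin n : p n \is a fin_num.
  by apply: fin_num_measure; exact: measurable_superlevel.
have upper (eta : R) : 0 < eta ->
    \forall n \near \oo, (p n <= (expR (- (s n * (I - eta))))%:E)%E.
  move=> eta0; move: y0; rewrite le_eqVlt => /predU1P[y0|y0]; last first.
    by apply: sum_tail_upper => // t t0 t1; exact: rate_inf_le.
  (* At [y = 0] the rate vanishes at [theta = 0], and the bound by probability 1 suffices. *)
  have I0 : I <= 0.
    apply: le_trans (rate_inf_le y (lexx 0) ler01) _.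
    rewrite /rate -y0 powR0 ?gt_eqF ?subr_gt0//.
    by rewrite expr0n/= !mulr0 mul0r addr0.
  near=> n; have n0 : (0 < n)%N by near: n.
  rewrite (@le_trans _ _ 1%E) ?probability_le1//; first by exact: measurable_superlevel.
  rewrite lee_fin -expR0 ler_expR oppr_ge0 mulr_ge0_le0//; first by rewrite ltW// s_gt0.
  by lra.
have lower (eta : R) : 0 < eta ->
    \forall n \near \oo, ((expR (- (s n * (I + eta))))%:E <= p n)%E.
  move=> eta0; have eta3 : 0 < eta / 3 by rewrite divr_gt0.
  have [t [t0 t1 rt]] := rate_inf_adherent y eta3.
  have [u [a [u0 a0 yua ua]]] := rate_perturb y0 t0 t1 eta3.
  have h := sum_tail_lower u0 a0 eta3.
  near=> n; have n0 : (0 < n)%N by near: n.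
  have sr : 0 < s n * r n by rewrite mulr_gt0 ?s_gt0 ?r_gt0.
  apply: (@le_trans _ _ (P [set w | (u + a) * (s n * r n) <= \sum_i Yrow n i w])).
    apply: (@le_trans _ _ (expR (- (s n *
        (q * u `^ (1 - eps) + a ^+ 2 / (2 * sigma ^+ 2) + eta / 3))))%:E); last first.
      by near: n; exact: h.
    by rewrite lee_fin ler_expR lerN2 ler_pM2l ?s_gt0//; move: rt ua; rewrite -/I; lra.
  apply: le_measure; rewrite ?inE; try exact: measurable_superlevel.
  by move=> w /=; apply: le_trans; rewrite ler_pM2r.
have scale n : (0 < n)%N -> ((((1 / (N n)%:R `^ ((1 - eps) / (1 + eps)))%R)%:E *
    lne (P [set w | ((N n)%:R `^ (1 / (1 + eps)) * y
                    <= \sum_(i < N n) Yrow n i w)%R])) = (1 / s n)%:E * lne (p n))%E.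
  move=> n0; rewrite !div1r -alphaE powNalpha//.
  by rewrite /p [y * _]mulrC [(1 - eps) * alpha]mulrC.
(* The logarithm is eventually finite because the lower bound makes the probability positive; the
   convergence is then a statement about reals. *)
apply: cvg_EFin; last apply/cvgrPdist_le => eta eta0.
- have lo := lower 1 ltr01.
  near=> n; have n0 : (0 < n)%N by near: n.
  rewrite scale//; have pge : ((expR (- (s n * (I + 1))))%:E <= p n)%E by near: n; exact: lo.
  have p0 : 0 < fine (p n).
    by rewrite -lte_fin fineK//; apply: lt_le_trans pge; rewrite lte_fin expR_gt0.
  by rewrite -(fineK (pfin n)) lne_EFin.
- have lo := lower eta eta0; have up := upper eta eta0.
  near=> n; have n0 : (0 < n)%N by near: n.
  have ple : (p n <= (expR (- (s n * (I - eta))))%:E)%E by near: n; exact: up.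
  have pge : ((expR (- (s n * (I + eta))))%:E <= p n)%E by near: n; exact: lo.
  rewrite /= scale//; move: ple pge; rewrite -(fineK (pfin n)) !lee_fin => ple pge.
  have p0 : 0 < fine (p n) by apply: lt_le_trans pge; exact: expR_gt0.
  rewrite lne_EFin//= div1r.
  have s0 := s_gt0 n0.
  have lnu : ln (fine (p n)) <= - (s n * (I - eta)) by rewrite -ler_expR lnK.
  have lnl : - (s n * (I + eta)) <= ln (fine (p n)) by rewrite -ler_expR lnK.
  rewrite ler_norml mulrC; apply/andP; split.
    by rewrite lerBrDr addrC -lerBrDr ler_pdivrMr//; lra.
  by rewrite lerBlDr -lerBlDl ler_pdivlMr//; lra.
Unshelve. all: by end_near. Qed.

End triangular_array.

Theorem theorem3 (R : realType) (d : measure_display)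
    (Omega : measurableType d) (P : probability Omega R)
    (Y : nat -> {RV P >-> R}) (N : nat -> nat)
    (Yrow : forall n : nat, 'I_(N n) -> {RV P >-> R})
    (Y_integrable : forall n, (0 < n)%N ->
       P.-integrable setT (fun w => (Y n w)%:E))
    (Y_centered : forall n, (0 < n)%N -> ('E_P[Y n] = 0)%E)
    (N_pos : forall n, (0 < n)%N -> (1 <= N n)%N)
    (N_cvg : N n @[n --> \oo] --> \oo)
    (Yrow_indep : forall n, (0 < n)%N -> independent_RVs (Yrow n))
    (Yrow_law : forall n, (0 < n)%N ->
       forall i : 'I_(N n), same_law (Yrow n i) (Y n))
    (eps q sigma alpha : R)
    (eps_gt0 : 0 < eps) (eps_lt1 : eps < 1)
    (q_gt0 : 0 < q) (sigma_gt0 : 0 < sigma)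
    (alphaE : alpha = (1 + eps)^-1)
    (tail : forall y : nat -> R,
       (forall n, (0 < n)%N -> 0 < y n) ->
       dominated (fun n => (N n)%:R `^ (alpha * eps)) y ->
       dominated y (fun n => (N n)%:R `^ alpha) ->
       asymp_equiv (fun n => lne (P [set w | y n <= Y n w]))
                   (fun n => - q * y n `^ (1 - eps)))
    (second_moment :
       'E_P[fun w => (Y n w ^+ 2)%R]%E @[n --> \oo] --> (sigma ^+ 2)%:E)
    (higher_moment : exists gamma : R, [/\ 0 < gamma, gamma <= 1 &
       asymp_negligible (fun n => 'E_P[fun w => (`|Y n w| `^ (2 + gamma))%R]%E)
                        (fun n => (N n)%:R `^ (gamma * (1 - alpha)))]) :
  forall y : R, 0 <= y ->
    (((1 / (N n)%:R `^ ((1 - eps) / (1 + eps)))%R)%:E *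
      lne (P [set w | ((N n)%:R `^ (1 / (1 + eps)) * y
                      <= \sum_(i < N n) Yrow n i w)%R]))%E
      @[n --> \oo] -->
    (- inf [set q * theta `^ (1 - eps) * y `^ (1 - eps)
                + (1 - theta) ^+ 2 * y ^+ 2 / (2 * sigma ^+ 2)
           | theta in [set t : R | 0 <= t <= 1]])%:E.

Proof.
have [gamma [gamma0 gamma1 higher]] := higher_moment.
exact: (scaled_log_cvg Y_integrable Y_centered N_pos N_cvg Yrow_indep Yrow_law
  eps_gt0 eps_lt1 q_gt0 sigma_gt0 alphaE tail second_moment gamma0 gamma1 higher).
Qed.
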